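(* Let $a$ be an odd natural number. Let $n$ sensors be placed independently and uniformly at random in the unit interval $[0,1]$, and let $X_i$ denote the position of the $i$-th closest sensor to $0$ (the $i$-th order statistic), $i=1,\dots,n$. Let $t_i=\frac{i}{n}-\frac{1}{2n}$. Then, as $n\to\infty$, $$\sum_{i=1}^n\mathbf{E}\left[\left|X_i-t_i\right|^a\right]=\frac{\Gamma\left(\frac{a}{2}+1\right)}{2^{\frac{a}{2}}(1+a)}\frac{1}{n^{\frac{a}{2}-1}}+O\left(\frac{1}{n^{\frac{a-1}{2}}}\right),$$ where $\Gamma$ is the Gamma function.
   Context: The quantity $\sum_{i=1}^n \mathbf{E}[|X_i-t_i|^a]$ is the expected total cost, with displacement cost raised to the power $a$, of moving the $i$-th sensor (in sorted order) to the anchor point $t_i$ for every $i$. *)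

(* Defs.v *)
From HB Require Import structures.
From mathcomp Require Import all_boot all_order all_algebra.
From mathcomp Require Import all_classical all_reals all_analysis.

Set Implicit Arguments.
Unset Strict Implicit.
Unset Printing Implicit Defensive.

Import Order.TTheory GRing.Theory Num.Theory.
Import numFieldNormedType.Exports.

Local Open Scope classical_set_scope.
Local Open Scope ring_scope.

(* Euler's integral; it is the Gamma function only for 0 < x, where it
   converges. *)
Definition Gamma {R : realType} (x : R) : R :=
  \int[lebesgue_measure]_(t in `]0, +oo[) (t `^ (x - 1) * expR (- t)).

Definition mutually_independent {d : measure_display} {T : measurableType d}
    {R : realType} (P : probability T R) {I : finType} (U : I -> {RV P >-> R}) :
    Prop :=
  forall (J : {set I}) (B : I -> set R),
    (forall i, measurable (B i)) ->
    P (\bigcap_(i in [set` J]) (U i @^-1` B i)) =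
    (\prod_(i in J) P (U i @^-1` B i))%E.

Definition uniform_on_unit_interval {d : measure_display}
    {T : measurableType d} {R : realType} (P : probability T R)
    (U : {RV P >-> R}) : Prop :=
  forall B : set R, measurable B ->
    distribution P U B = uniform_prob (ltr01 : (0 : R) < 1) B.

(* [order_stat U i] is the (i+1)-st smallest of the n values: ordinals start
   at 0. *)
Definition order_stat {T : Type} {R : realType} {n : nat} (U : 'I_n -> T -> R)
    (i : 'I_n) (w : T) : R :=
  nth 0 (sort <=%R [seq U j w | j <- enum 'I_n]) i.

(* The anchor of the (i+1)-st sensor, i.e. t_(i+1) = (i+1)/n - 1/(2n). *)
Definition anchor {R : realType} {n : nat} (i : 'I_n) : R :=
  i.+1%:R / n%:R - (2 * n%:R)^-1.

(* Main.v *)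
(** A sensor at [x] has rank [K + 1] with [K] binomial of parameters [n - 1] and
    [x], so the expected cost is [n^(1-a)] times the integral over [x] in
    [[0, 1]] of [E |K + 1/2 - n x|^a]; formally, the order statistics follow
    beta laws, whose densities add up to binomial weights.  With [m = n - 1],
    replacing [K + 1/2 - n x] by [K - m x] costs even moments of order [a - 1],
    that is [O(n^((a-1)/2))].  The weight [w = x^k (1-x)^(m-k)] satisfies
    [x (1-x) w' = (k - m x) w], so integrating by parts on both sides of the
    mode [k / m] lowers the exponent by two, at the same cost, until only the
    values of the weights at their modes are left.  Stirling's formula turns
    the sum of these into a convolution of the coefficients of
    [(1-z)^(-q-1/2)], [q = (a+1)/2], which is a coefficient of [(1-z)^(-2q-1)].
    Stirling's constant is [sqrt 2 * Gamma (1/2)] because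
    [Gamma (k + 1/2) / k!] is squeezed by the log-convexity of Gamma. *)

Require Import Defs.
From HB Require Import structures.
From mathcomp Require Import all_boot all_order all_algebra.
From mathcomp Require Import all_classical all_reals all_analysis.
From mathcomp Require Import measurable_realfun.
From mathcomp Require Import ring lra.
Import Order.TTheory GRing.Theory Num.Theory.
Import numFieldNormedType.Exports.
Local Open Scope classical_set_scope.
Local Open Scope ring_scope.

(** * Integrals of continuous functions *)

Section IntegralOfContinuous.
Context {R : realType}.
Notation mu := (@lebesgue_measure R).
Implicit Types (f g F : R -> R) (a b c : R).

(** As [a] is odd, [|K - m x|^a] is not a polynomial in [x], so its mean has no closed moment
    formula, and a normal approximation at fixed [x] would need an error uniform up to 0 and 1.
    Summing over the rank last avoids both: for fixed [k] the absolute value is a polynomial on each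
    side of [k / m], and the factor [x (1-x)] kills the boundary terms at 0 and 1. Write
    [a = 2 p + 1], so [q = p + 1]. The scaled cost has order [n^(p + 1/2)], and every replacement
    may cost [n^p], half a power less. Integrating an odd moment by parts leaves even moments as
    errors, and the same integration by parts bounds those. The sum of the modal values resembles a
    Riemann sum for the integral of [(x (1-x))^(p + 1/2)]. Trading half-integer powers of [k] for
    series coefficients turns it into an exact convolution, so no quadrature error has to be
    estimated. [Gamma (1/2)] is never evaluated: it enters with Stirling's constant and leaves by
    the duplication formula. *)

Lemma integrable_continuous f a b : continuous f ->
  mu.-integrable `[a, b] (EFin \o f).
Proof.
move=> cf; apply: continuous_compact_integrable; first exact: segment_compact.
exact: continuous_subspaceT.
Qed.

Lemma Rintegral_derive F f a b : a <= b -> continuous f ->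
  (forall x : R, is_derive x 1 F (f x)) ->
  \int[mu]_(x in `[a, b]) f x = F b - F a.
Proof.
rewrite le_eqVlt => /predU1P[<- _ _|ab cf dF].
  by rewrite set_itv1 Rintegral_set1 subrr.
have cF : continuous F.
  move=> x; apply/differentiable_continuous/derivable1_diffP; exact: ex_derive.
rewrite /Rintegral (@continuous_FTC2 _ f F)//.
- exact: continuous_subspaceT.
- split=> [x _|//|//].
  + exact: ex_derive.
  + exact/cvg_at_right_filter/cF.
  + exact/cvg_at_left_filter/cF.
- by move=> x _; rewrite derive1E; apply: derive_val.
Qed.

Lemma Rintegral_chasles f a b c : a <= c -> c <= b -> continuous f ->
  \int[mu]_(x in `[a, b]) f x =
  \int[mu]_(x in `[a, c]) f x + \int[mu]_(x in `[c, b]) f x.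
Proof.
move=> ac cb cf.
have := @Rintegral_itvB R f (BLeft a) (BRight b) c (integrable_continuous f a b cf).
rewrite !bnd_simp => /(_ ac cb) E.
rewrite -[X in _ + X]Rintegral_itv_obnd_cbnd.
  by rewrite -E addrC subrK.
apply: integrableS (integrable_continuous f c b cf) => //=.
exact: subset_itv_oc_cc.
Qed.

End IntegralOfContinuous.

(** * Integration by parts against the binomial weights *)

(** The three polynomials are locked so that simplification, [hornerE] and [ring] treat them as
    atoms. *)
HB.lock Definition binom_poly {R : realType} (k l : nat) : {poly R} :=
  'X^k * (1 - 'X) ^+ l.

(** This is [k - (k + l) x], the deviation of the count from its mean, in the shape that the product
    rule yields for [x^k (1-x)^l]. *)
HB.lock Definition dev_poly {R : realType} (k l : nat) : {poly R} :=
  k%:R *: (1 - 'X) - l%:R *: 'X.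

HB.lock Definition var_poly {R : realType} : {poly R} := 'X * (1 - 'X).

Section BinomialKernel.
Context {R : realType}.
Notation mu := (@lebesgue_measure R).
Implicit Types (p q : {poly R}) (a b e x : R) (k l i j : nat).

Lemma continuous_horner p : continuous (horner p).
Proof.
by move=> x; apply/differentiable_continuous/derivable1_diffP/derivable_horner.
Qed.

Definition poly_int (a b : R) (p : {poly R}) : R :=
  \int[mu]_(x in `[a, b]) p.[x].

Lemma poly_intD a b p q : poly_int a b (p + q) = poly_int a b p + poly_int a b q.
Proof.
rewrite /poly_int -RintegralD//; try exact/integrable_continuous/continuous_horner.
by apply: eq_Rintegral => x _; rewrite hornerD.
Qed.

Lemma poly_intZ a b e p : poly_int a b (e *: p) = e * poly_int a b p.
Proof.
rewrite /poly_int -RintegralZl//; last exact/integrable_continuous/continuous_horner.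
by apply: eq_Rintegral => x _; rewrite hornerZ.
Qed.

Lemma poly_int_deriv a b p : a <= b -> poly_int a b p^`() = p.[b] - p.[a].
Proof.
by move=> ab; apply: Rintegral_derive => //; exact: continuous_horner.
Qed.

Lemma le_poly_int a b p q : (forall x, a <= x <= b -> p.[x] <= q.[x]) ->
  poly_int a b p <= poly_int a b q.
Proof.
move=> pq; apply: le_Rintegral => //; try exact/integrable_continuous/continuous_horner.
Qed.

Lemma ler_norm_poly_int a b p q :
  (forall x, a <= x <= b -> `|p.[x]| <= q.[x]) ->
  `|poly_int a b p| <= poly_int a b q.
Proof.
move=> pq; rewrite ler_norml -[- poly_int a b q]mulN1r -poly_intZ.
apply/andP; split; apply: le_poly_int => x /pq; rewrite ler_norml => /andP[//].
by rewrite hornerZ mulN1r.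
Qed.

Lemma binom_poly_deriv k l :
  var_poly * (binom_poly k l)^`() = dev_poly k l * binom_poly k l :> {poly R}.
Proof.
rewrite var_poly.unlock binom_poly.unlock dev_poly.unlock /= derivM derivXn deriv_exp derivB derivX.
rewrite derivC sub0r.
(* At [k = 0] the truncated [k.-1] is harmless because its coefficient vanishes; likewise for [l] in
   [E2]. *)
have E1 : ('X : {poly R}) * ('X^(k.-1) *+ k) = k%:R *: 'X^k.
  by case: k => [|k]; rewrite ?mulr0n ?mulr0 ?scale0r// mulrnAr -exprS scaler_nat.
have E2 : (1 - 'X : {poly R}) * (- 1 * (1 - 'X) ^+ l.-1 *+ l) = - l%:R *: (1 - 'X) ^+ l.
  case: l => [|l]; rewrite ?mulr0n ?mulr0 ?oppr0 ?scale0r//.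
  by rewrite mulN1r mulrnAr mulrN -exprS scaleNr scaler_nat mulNrn.
rewrite mulrDr mulrACA E1 [X in _ + X = _]mulrACA E2.
by rewrite -!mul_polyC polyCN; ring.
Qed.

(** The sign [e] makes [e *: dev_poly] stand for the absolute deviation while remaining a
    polynomial; [e ^+ 2 = 1] turns the bare deviation produced by [binom_poly_deriv] into one more
    factor of it. The middle term comes from differentiating the power of [var_poly] and becomes the
    error. *)
Lemma kernel_deriv k l i j e : e ^+ 2 = 1 ->
  ((e *: dev_poly k l) ^+ i * var_poly ^+ j.+1 * binom_poly k l)^`() =
  (- (e * (k + l)%:R * i%:R)) *:
    ((e *: dev_poly k l) ^+ i.-1 * var_poly ^+ j.+1 * binom_poly k l)
  + j.+1%:R *: ((e *: dev_poly k l) ^+ i * ((1 - 2%:R *: 'X) * (var_poly ^+ j * binom_poly k l)))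
  + e *: ((e *: dev_poly k l) ^+ i.+1 * var_poly ^+ j * binom_poly k l).
Proof.
move=> e2; rewrite derivM [X in X * binom_poly k l]derivM !deriv_exp derivZ.
have -> : (dev_poly k l)^`() = - ((k + l)%:R)%:P :> {poly R}.
  rewrite dev_poly.unlock derivB !derivZ derivB derivX derivC sub0r natrD.
  by rewrite -!mul_polyC polyCD; ring.
have -> : var_poly^`() = 1 - 2%:R *: 'X :> {poly R}.
  by rewrite var_poly.unlock /= derivM derivB derivX derivC -mul_polyC; ring.
have -> : (e *: dev_poly k l) ^+ i * var_poly ^+ j.+1 * (binom_poly k l)^`()
  = e *: ((e *: dev_poly k l) ^+ i.+1 * var_poly ^+ j * binom_poly k l).
  have : e%:P ^+ 2 = 1 :> {poly R} by rewrite -rmorphXn/= e2.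
  have := binom_poly_deriv k l; rewrite -!mul_polyC.
  move: var_poly (dev_poly k l) (binom_poly k l) (binom_poly k l)^`() => v D W W' E e2'.
  have -> : (e%:P * D) ^+ i * v ^+ j.+1 * W' = (e%:P * D) ^+ i * v ^+ j * (v * W').
    by rewrite exprSr !mulrA.
  rewrite E [in RHS]exprSr.
  have -> : e%:P * ((e%:P * D) ^+ i * (e%:P * D) * v ^+ j * W)
    = e%:P ^+ 2 * ((e%:P * D) ^+ i * v ^+ j * (D * W)).
    by move: ((e%:P * D) ^+ i) (v ^+ j) => ? ?; ring.
  by rewrite e2' mul1r.
move: var_poly (dev_poly k l) (binom_poly k l) => v D W.
rewrite -!mul_polyC !polyCN !polyCM !polyC_natr /=.
rewrite -(mulr_natr _ i) -(mulr_natr _ j.+1).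
move: ((e%:P * D) ^+ i) ((e%:P * D) ^+ i.-1) (v ^+ j) (v ^+ j.+1) => ? ? ? ?.
ring.
Qed.

Lemma binom_polyE k l x : (binom_poly k l).[x] = x ^+ k * (1 - x) ^+ l.
Proof. by rewrite binom_poly.unlock /= !hornerE. Qed.

Lemma dev_polyE k l x : (dev_poly k l).[x] = k%:R - (k + l)%:R * x.
Proof. by rewrite dev_poly.unlock /= !hornerE natrD; ring. Qed.

Lemma var_polyE x : var_poly.[x] = x * (1 - x).
Proof. by rewrite var_poly.unlock /= !hornerE. Qed.

Lemma binom_poly_ge0 k l x : 0 <= x <= 1 -> 0 <= (binom_poly k l).[x].
Proof.
by move=> /andP[x0 x1]; rewrite binom_polyE mulr_ge0// ?exprn_ge0// subr_ge0.
Qed.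

Lemma var_poly_ge0 x : 0 <= x <= 1 -> 0 <= var_poly.[x].
Proof. by move=> /andP[x0 x1]; rewrite var_polyE mulr_ge0//; lra. Qed.

Lemma var_poly_le1 x : 0 <= x <= 1 -> var_poly.[x] <= 1.
Proof. by move=> /andP[x0 x1]; rewrite var_polyE; nra. Qed.

(* [e] is the sign of the deviation on [[a, b]]. *)
Lemma kernel_by_parts k l i j a b e
    (G := (e *: dev_poly k l) ^+ i * var_poly ^+ j.+1 * binom_poly k l) :
  0 <= a -> a <= b -> b <= 1 -> e ^+ 2 = 1 ->
  (forall x, a <= x <= b -> 0 <= e * (dev_poly k l).[x]) ->
  `|poly_int a b ((e *: dev_poly k l) ^+ i.+1 * var_poly ^+ j * binom_poly k l)
    - (k + l)%:R * i%:R *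
      poly_int a b ((e *: dev_poly k l) ^+ i.-1 * var_poly ^+ j.+1 * binom_poly k l)
    - e * (G.[b] - G.[a])| <=
  j.+1%:R * poly_int a b ((e *: dev_poly k l) ^+ i * binom_poly k l).
Proof.
move=> a0 ab b1 e2 U0.
have := poly_int_deriv a b G ab; rewrite kernel_deriv// !poly_intD !poly_intZ.
set I1 := poly_int _ _ _; set I2 := poly_int _ _ _; set I3 := poly_int _ _ _.
move=> <-; have -> : I3 - (k + l)%:R * i%:R * I1 -
    e * (- (e * (k + l)%:R * i%:R) * I1 + j.+1%:R * I2 + e * I3) =
    - (e * (j.+1%:R * I2)) + (1 - e ^+ 2) * (I3 - (k + l)%:R * i%:R * I1) by ring.
rewrite e2 subrr mul0r addr0 normrN normrM.
have -> : `|e| = 1.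
  by apply/eqP; rewrite -(@eqrXn2 _ 2)// -normrX e2 normr1 expr1n.
rewrite mul1r normrM ger0_norm// ler_wpM2l//.
apply: ler_norm_poly_int => x /[dup] /U0 Ux /andP[ax xb].
have x01 : 0 <= x <= 1 by rewrite (le_trans a0 ax) (le_trans xb b1).
rewrite !hornerM !horner_exp hornerZ.
rewrite normrM ger0_norm ?exprn_ge0// ler_wpM2l ?exprn_ge0//.
rewrite mulrA normrM [X in _ * X]ger0_norm ?binom_poly_ge0//.
(* On [[0, 1]] both [|1 - 2 x|] and [x (1 - x)] are at most 1, so the remainder can drop them. *)
rewrite ler_piMl ?binom_poly_ge0// normrM mulr_ile1//.
  by rewrite !hornerE ler_norml; move/andP: x01 => [? ?]; lra.
rewrite ger0_norm ?exprn_ge0 ?var_poly_ge0//.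
by rewrite exprn_ile1 ?var_poly_ge0 ?var_poly_le1.
Qed.

Definition abs_moment k l i j : R :=
  \int[mu]_(x in `[0, 1]) (`|(dev_poly k l).[x]| ^+ i *
     (var_poly.[x] ^+ j * (binom_poly k l).[x])).

Lemma abs_moment_split k l i j : (0 < k + l)%N ->
  abs_moment k l i j =
    poly_int 0 (k%:R / (k + l)%:R) ((1 *: dev_poly k l) ^+ i * var_poly ^+ j * binom_poly k l) +
    poly_int (k%:R / (k + l)%:R) 1 (((-1) *: dev_poly k l) ^+ i * var_poly ^+ j * binom_poly k l).
Proof.
move=> kl0; have kl : 0 < (k + l)%:R :> R by rewrite ltr0n.
have c0 : 0 <= k%:R / (k + l)%:R :> R by rewrite divr_ge0.
have c1 : k%:R / (k + l)%:R <= 1 :> R.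
  by rewrite ler_pdivrMr// mul1r ler_nat leq_addr.
rewrite /abs_moment (Rintegral_chasles _ _ _ _ c0 c1).
  congr (_ + _); apply: eq_Rintegral => x; rewrite inE/= in_itv/= => /andP[h1 h2].
    rewrite !hornerM !horner_exp hornerZ mul1r -mulrA ger0_norm//.
    by rewrite dev_polyE subr_ge0 mulrC -ler_pdivlMr.
  rewrite !hornerM !horner_exp hornerZ mulN1r -mulrA ler0_norm//.
  by rewrite dev_polyE subr_le0 mulrC -ler_pdivrMr.
have cp p : continuous (fun x => `|p.[x]| ^+ i).
  move=> x; apply: (@continuous_comp _ _ _ (fun x => `|p.[x]|) (fun y : R => y ^+ i)).
    by apply: continuous_comp; [exact: continuous_horner|exact: norm_continuous].
  exact: exprn_continuous.
move=> x; apply: cvgM; first exact: cp.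
under eq_fun do rewrite -horner_exp -hornerM.
rewrite -horner_exp -hornerM; exact: continuous_horner.
Qed.

(** Boundary terms at 0 and 1 vanish with [var_poly], whose exponent is positive. At the mode the
    deviation vanishes, so that boundary term survives only for [i = 0], once from each side: hence
    [0 ^+ i * 2]. For [i = 0] the truncated [i.-1] carries the coefficient 0. *)
Lemma abs_moment_by_parts k l i j (c : R := k%:R / (k + l)%:R) :
  (0 < k + l)%N ->
  `|abs_moment k l i.+1 j - (k + l)%:R * i%:R * abs_moment k l i.-1 j.+1
    - 0 ^+ i * 2 * ((c * (1 - c)) ^+ j.+1 * (binom_poly k l).[c])| <=
  j.+1%:R * abs_moment k l i 0.
Proof.
move=> kl0; have kl : 0 < (k + l)%:R :> R by rewrite ltr0n.
have c0 : 0 <= c by rewrite divr_ge0.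
have c1 : c <= 1 by rewrite ler_pdivrMr// mul1r ler_nat leq_addr.
have H1 := kernel_by_parts k l i j 0 c 1 (lexx 0) c0 c1 (expr1n _ _).
have H2 := kernel_by_parts k l i j c 1 (-1) c0 c1 (lexx 1) (sqrr_sign _ 1).
rewrite !abs_moment_split// -/c !expr0 !mulr1.
have {}H1 := H1 _; have {}H2 := H2 _.
apply: le_trans; last first.
  rewrite mulrDr; apply: lerD; [apply: H1|apply: H2] => x /andP[h1 h2].
    by rewrite mul1r dev_polyE subr_ge0 mulrC -ler_pdivlMr.
  by rewrite mulN1r oppr_ge0 dev_polyE subr_le0 mulrC -ler_pdivrMr.
apply: le_trans (ler_normD _ _); rewrite le_eqVlt; apply/orP; left; apply/eqP.
congr (`|_|).
have devc : (dev_poly k l).[c] = 0.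
  by rewrite dev_polyE /c mulrC divfK ?subrr// gt_eqF.
rewrite !hornerM !horner_exp !hornerZ devc !mulr0 !var_polyE subrr mulr0 mul0r.
rewrite !expr0n/= -var_polyE; ring.
Qed.

End BinomialKernel.

(** * Binomial moments *)

Section Moments.
Context {R : realType}.
Notation mu := (@lebesgue_measure R).
Implicit Types (x : R) (k l i j m p q : nat).

Lemma continuous_abs_kernel (P Q : {poly R}) i :
  continuous (fun x => `|P.[x]| ^+ i * Q.[x]).
Proof.
move=> x; apply: cvgM; last exact: continuous_horner.
apply: (@continuous_comp _ _ _ (fun x => `|P.[x]|) (fun y : R => y ^+ i)).
  by apply: continuous_comp; [exact: continuous_horner|exact: norm_continuous].
exact: exprn_continuous.
Qed.

Lemma abs_momentE k l i j : abs_moment k l i j =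
  \int[mu]_(x in `[0, 1]) (`|(dev_poly k l).[x]| ^+ i * (var_poly ^+ j * binom_poly k l).[x]).
Proof. by apply: eq_Rintegral => x _; rewrite hornerM horner_exp. Qed.

Lemma abs_moment_ge0 k l i j : 0 <= abs_moment k l i j :> R.
Proof.
apply: Rintegral_ge0 => x; rewrite /= in_itv/= => x01.
by rewrite !mulr_ge0 ?exprn_ge0 ?binom_poly_ge0 ?var_poly_ge0.
Qed.

Lemma abs_moment_le k l i j : abs_moment k l i j <= abs_moment k l i 0 :> R.
Proof.
rewrite !abs_momentE; apply: le_Rintegral => //;
  try exact/integrable_continuous/continuous_abs_kernel.
move=> x; rewrite /= in_itv/= => x01.
rewrite ler_wpM2l ?exprn_ge0// !hornerM ler_wpM2r ?binom_poly_ge0//.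
by rewrite !horner_exp expr0 exprn_ile1 ?var_poly_ge0 ?var_poly_le1.
Qed.

(** Bounds a moment by its two neighbours, from [(t - 1)^2 >= 0]. It lets the error of an
    integration by parts be absorbed in [binom_moment_even]. *)
Lemma abs_moment_amgm k l i :
  2 * abs_moment k l i.+1 0 <= abs_moment k l i.+2 0 + abs_moment k l i 0 :> R.
Proof.
rewrite !abs_momentE -RintegralD//; try exact/integrable_continuous/continuous_abs_kernel.
rewrite -RintegralZl//; last exact/integrable_continuous/continuous_abs_kernel.
apply: le_Rintegral => //.
- apply: integrable_continuous => x; apply: cvgM; first exact: cvg_cst.
  exact: continuous_abs_kernel.
- apply: integrable_continuous => x; apply: cvgD; exact: continuous_abs_kernel.
move=> x; rewrite /= in_itv/= => x01; rewrite -mulrDl mulrA ler_wpM2r//.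
  by rewrite expr0 mul1r binom_poly_ge0.
rewrite -subr_ge0.
set t := `|_|; have -> : t ^+ i.+2 + t ^+ i - 2 * t ^+ i.+1 = (t - 1) ^+ 2 * t ^+ i.
  by rewrite !exprS; ring.
by rewrite mulr_ge0 ?sqr_ge0// exprn_ge0// /t normr_ge0.
Qed.

Definition binom_moment m i j : R :=
  \sum_(k < m.+1) 'C(m, k)%:R * abs_moment k (m - k) i j.

(** Collects the boundary terms at the modes [k / m] over all [k]. *)
Definition mode_sum m q : R :=
  \sum_(k < m.+1) 'C(m, k)%:R * ((k%:R / m%:R * (1 - k%:R / m%:R)) ^+ q *
     (binom_poly k (m - k)).[k%:R / m%:R]).

Lemma binom_moment_ge0 m i j : 0 <= binom_moment m i j.
Proof. by apply: sumr_ge0 => k _; rewrite mulr_ge0// abs_moment_ge0. Qed.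

Lemma binom_moment_by_parts m i j : (0 < m)%N ->
  `|binom_moment m i.+1 j - m%:R * i%:R * binom_moment m i.-1 j.+1
    - 0 ^+ i * 2 * mode_sum m j.+1| <= j.+1%:R * binom_moment m i 0.
Proof.
move=> m0; rewrite /binom_moment /mode_sum !mulr_sumr -!sumrB.
apply: le_trans (ler_norm_sum _ _ _) _; apply: ler_sum => k _.
have kmE : (k + (m - k))%N = m by rewrite subnKC// -ltnS.
have := @abs_moment_by_parts R k (m - k) i j; rewrite kmE => /(_ m0).
set c := _ / _; move: (abs_moment _ _ _ _) (abs_moment _ _ _ _) (abs_moment _ _ _ _) => D B A H.
have -> : 'C(m, k)%:R * A - m%:R * i%:R * ('C(m, k)%:R * B) -
    0 ^+ i * 2 * ('C(m, k)%:R * ((c * (1 - c)) ^+ j.+1 * (binom_poly k (m - k)).[c]))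
  = 'C(m, k)%:R * (A - m%:R * i%:R * B - 0 ^+ i * 2 * ((c * (1 - c)) ^+ j.+1 * (binom_poly k (m - k)).[c])).
  by move: (0 ^+ i) (_ ^+ j.+1) => ? ?; ring.
by rewrite normrM ger0_norm// [leRHS]mulrCA ler_wpM2l.
Qed.

Lemma binom_moment00 m : binom_moment m 0 0 = 1.
Proof.
rewrite /binom_moment.
have -> : \sum_(k < m.+1) 'C(m, k)%:R * abs_moment k (m - k) 0 0 =
   poly_int 0 1 (\sum_(k < m.+1) 'C(m, k)%:R *: binom_poly k (m - k)) :> R.
  rewrite (big_morph _ (@poly_intD R 0 1) (_ : _ = 0)).
    apply: eq_bigr => k _; rewrite poly_intZ; congr (_ * _).
    by apply: eq_Rintegral => x _; rewrite !expr0 !mul1r.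
  by rewrite -[X in poly_int _ _ X](scale0r 0) poly_intZ mul0r.
(* The weights add up to the constant 1, written as a derivative so that [poly_int_deriv] integrates
   it. *)
have -> : \sum_(k < m.+1) 'C(m, k)%:R *: binom_poly k (m - k) = deriv ('X : {poly R}).
  rewrite derivX -[RHS](expr1n _ m) -[in RHS](subrK 'X 1) exprDn.
  by apply: eq_bigr => k _; rewrite binom_poly.unlock scaler_nat mulrC.
by rewrite poly_int_deriv ?ler01// !hornerX subr0.
Qed.

(** One integration by parts bounds the moment of order [i + 2] by [m (i + 1)] times that of order
    [i], plus the moment of order [i + 1]. AM-GM splits the latter into halves of its neighbours,
    and the upper half moves to the left; this doubles the constant. *)
Lemma binom_moment_even m i : (0 < m)%N ->
  binom_moment m i.+2 0 <= (2 * m%:R * i.+1%:R + 1) * binom_moment m i 0.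
Proof.
move=> m0; have := binom_moment_by_parts m i.+1 0 m0.
rewrite exprS !mul0r subr0 mul1r /= => /(le_trans (ler_norm _)).
have : binom_moment m i 1 <= binom_moment m i 0.
  by apply: ler_sum => k _; rewrite ler_wpM2l// abs_moment_le.
have : 2 * binom_moment m i.+1 0 <= binom_moment m i.+2 0 + binom_moment m i 0.
  rewrite mulr_sumr -big_split/=; apply: ler_sum => k _.
  by rewrite mulrCA -mulrDr ler_wpM2l// abs_moment_amgm.
have t0 : 0 <= m%:R * i.+1%:R :> R by rewrite mulr_ge0.
move=> H1 H2 H3; have := ler_wpM2l t0 H2.
move: H3; rewrite -(mulrA 2); move: (m%:R * _) => t; lra.
Qed.

Lemma binom_moment_even_bound i : exists2 C : R, 0 <= C &
  forall m, (0 < m)%N -> binom_moment m (2 * i) 0 <= C * m%:R ^+ i.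
Proof.
elim: i => [|i [C C0 IH]].
  by exists 1 => // m m0; rewrite muln0 binom_moment00 expr0 mulr1.
exists ((2 * (2 * i).+1%:R + 1) * C); first by rewrite mulr_ge0// addr_ge0// mulr_ge0.
move=> m m0; rewrite mulnS (le_trans (binom_moment_even m _ m0))//.
have m1 : 1 <= m%:R :> R by rewrite ler1n.
rewrite exprS; apply: (@le_trans _ _ (((2 * (2 * i).+1%:R + 1) * m%:R) * binom_moment m (2 * i) 0)).
  rewrite ler_wpM2r ?binom_moment_ge0//; nra.
rewrite -mulrA -[leRHS]mulrA ler_wpM2l ?addr_ge0 ?mulr_ge0//.
by rewrite [leRHS]mulrCA ler_wpM2l// IH.
Qed.

(** Each step lowers the exponent by two, raises [j] by one and brings a factor [m] times an even
    number; the product [2 * 4 * ... * 2p] is [2 ^ p * p!]. The error of a step is an even moment,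
    of order [m ^ p] by [binom_moment_even_bound]. *)
Lemma binom_moment_odd_reduce p j : exists2 C : R, 0 <= C &
  forall m, (0 < m)%N ->
  `|binom_moment m (2 * p).+1 j - m%:R ^+ p * (2 ^+ p * p`!%:R) * binom_moment m 1 (j + p)|
  <= C * m%:R ^+ p.
Proof.
elim: p j => [|p IH] j.
  exists 0 => // m m0; rewrite muln0 addn0 !expr0 fact0 !mul1r subrr normr0; lra.
have [C C0 HC] := IH j.+1; have [D D0 HD] := binom_moment_even_bound p.+1.
exists ((2 * p.+1)%:R * C + j.+1%:R * D); first by rewrite addr_ge0// mulr_ge0.
move=> m m0; have m1 : 0 <= m%:R :> R by [].
have := binom_moment_by_parts m (2 * p.+1) j m0.
rewrite mulnS [0 ^+ _]exprS !mul0r subr0 /= => H.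
rewrite addnS -addSn.
set A := binom_moment _ _ _ in H *; set B := binom_moment m _ j.+1 in H.
set E := binom_moment m 1 _.
have -> : A - m%:R ^+ p.+1 * (2 ^+ p.+1 * p.+1`!%:R) * E =
  (A - m%:R * (2 + 2 * p)%:R * B) +
  m%:R * (2 * p.+1)%:R * (B - m%:R ^+ p * (2 ^+ p * p`!%:R) * E).
  rewrite factS !exprS -mulnS !natrM; move: (_ ^+ p) (_ ^+ p) => ? ?; ring.
apply: le_trans (ler_normD _ _) _; rewrite addrC mulrDl lerD//.
  rewrite normrM ger0_norm ?mulr_ge0// mulrC exprS.
  rewrite [leRHS](_ : _ = C * m%:R ^+ p * (m%:R * (2 * p.+1)%:R)).
    by rewrite ler_wpM2r ?mulr_ge0// HC.
  by move: (_ ^+ p) => ?; ring.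
by rewrite (le_trans H)// -mulrA ler_wpM2l// -mulnS HD.
Qed.

(** The last integration by parts, at exponent 1, is the only one with a surviving boundary term,
    namely [mode_sum]; its error is the total mass of the weights, which is 1. *)
Lemma binom_moment_odd p : exists2 C : R, 0 <= C &
  forall m, (0 < m)%N ->
  `|binom_moment m (2 * p).+1 0 - m%:R ^+ p * (2 ^+ p * p`!%:R) * (2 * mode_sum m p.+1)|
  <= C * m%:R ^+ p.
Proof.
have [C C0 H] := binom_moment_odd_reduce p 0.
exists (C + (2 ^+ p * p`!%:R) * p.+1%:R).
  by rewrite addr_ge0// !mulr_ge0// exprn_ge0.
move=> m m0; have := H m m0; rewrite add0n.
have := binom_moment_by_parts m 0 p m0.
rewrite expr0 mul1r !mulr0 mul0r subr0 binom_moment00 mulr1.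
set A := binom_moment _ _ _; set B := binom_moment _ _ _; set S := 2 * _.
set K := 2 ^+ p * _ => H1 H2.
have -> : B - m%:R ^+ p * K * S = (B - m%:R ^+ p * K * A) + m%:R ^+ p * K * (A - S) by ring.
apply: le_trans (ler_normD _ _) _; rewrite mulrDl lerD// normrM.
have K0 : 0 <= m%:R ^+ p * K by rewrite !mulr_ge0// exprn_ge0.
by rewrite ger0_norm// [leRHS]mulrC [leRHS]mulrA ler_wpM2l.
Qed.

(** The difference of powers factors into a difference of size at most 1 and a sum of [a + 1]
    products, each at most [(|u| + 1)^a]. Comparing [|u|] with 1 bounds this by
    [2^a (|u|^a + 1)]. *)
Lemma ler_norm_pow_shift (a : nat) (u d : R) : `|d| <= 1 ->
  `| `|u + d| ^+ a.+1 - `|u| ^+ a.+1| <= a.+1%:R * 2 ^+ a * (`|u| ^+ a + 1).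
Proof.
move=> d1; rewrite subrXX normrM.
set s := `|u + d|; set t := `|u|.
have t0 : 0 <= t by exact: normr_ge0.
have s0 : 0 <= s by exact: normr_ge0.
have st : `|s - t| <= 1.
  by apply: le_trans d1; rewrite /s /t (le_trans (ler_dist_dist _ _))// (addrC u) addrK.
have st1 : s <= t + 1 by move: st; rewrite ler_norml => /andP[]; lra.
have H : (t + 1) ^+ a <= 2 ^+ a * (t ^+ a + 1).
  have [t1|t1] := lerP t 1.
    apply: (@le_trans _ _ (2 ^+ a)); first by rewrite lerXn2r ?nnegrE//; lra.
    by rewrite ler_peMr ?exprn_ge0// lerDr exprn_ge0.
  apply: (@le_trans _ _ ((2 * t) ^+ a)); first by rewrite lerXn2r ?nnegrE//; lra.
  by rewrite exprMn ler_wpM2l ?exprn_ge0// lerDl.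
apply: le_trans (_ : 1 * (a.+1%:R * (t + 1) ^+ a) <= _); last first.
  by rewrite mul1r -mulrA ler_wpM2l.
apply: ler_pM => //; apply: le_trans (ler_norm_sum _ _ _) _.
rewrite [leRHS](_ : _ = \sum_(i < a.+1) (t + 1) ^+ a); last first.
  by rewrite sumr_const card_ord mulr_natl.
apply: ler_sum => i _; rewrite ger0_norm ?mulr_ge0 ?exprn_ge0//.
have -> : (t + 1) ^+ a = (t + 1) ^+ (a.+1.-1 - i) * (t + 1) ^+ i.
  by rewrite -exprD subnK// -ltnS.
by apply: ler_pM; rewrite ?exprn_ge0// lerXn2r ?nnegrE//; lra.
Qed.

(** With [n = k + l + 1] the quantity inside the absolute value is [k + 1/2 - n x], the displacement
    scaled by [n]. *)
Definition shifted_moment k l (a : nat) : R :=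
  \int[mu]_(x in `[0, 1]) (`|(dev_poly k l).[x] + (2^-1 - x)| ^+ a * (binom_poly k l).[x]).

Lemma shifted_moment_dist k l (a : nat) :
  `|shifted_moment k l a.+1 - abs_moment k l a.+1 0| <=
  a.+1%:R * 2 ^+ a * (abs_moment k l a 0 + abs_moment k l 0 0).
Proof.
have -> : shifted_moment k l a.+1 =
    \int[mu]_(x in `[0, 1]) (`|(dev_poly k l + (2^-1%:P - 'X)).[x]| ^+ a.+1 * (binom_poly k l).[x]).
  by apply: eq_Rintegral => x _; rewrite !hornerE.
have E i : abs_moment k l i 0 =
    \int[mu]_(x in `[0, 1]) (`|(dev_poly k l).[x]| ^+ i * (binom_poly k l).[x]).
  by rewrite abs_momentE expr0 mul1r.
have cK (P : {poly R}) i : mu.-integrable `[0, 1]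
   (EFin \o (fun x => `|P.[x]| ^+ i * (binom_poly k l).[x])).
  exact/integrable_continuous/continuous_abs_kernel.
rewrite !E -RintegralB// -RintegralD// -RintegralZl//; last first.
  by apply: integrable_continuous => x; apply: cvgD; exact: continuous_abs_kernel.
apply: le_trans (le_normr_Rintegral _ _) _ => //.
  by apply: integrable_continuous => x; apply: cvgB; exact: continuous_abs_kernel.
apply: le_Rintegral => //.
- apply: integrable_continuous => x; apply: (@cvg_comp _ _ _ _ (fun x : R => `|x|)); last exact: norm_continuous.
  apply: cvgB; exact: continuous_abs_kernel.
- apply: integrable_continuous => x; apply: cvgM; first exact: cvg_cst.
  apply: cvgD; exact: continuous_abs_kernel.
move=> x; rewrite /= in_itv/= => x01.
rewrite -mulrBl normrM [X in _ * X]ger0_norm ?binom_poly_ge0// -mulrDl mulrA.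
rewrite ler_wpM2r ?binom_poly_ge0// expr0 hornerD; apply: ler_norm_pow_shift.
by rewrite !hornerE ler_norml; move/andP: x01 => [? ?]; lra.
Qed.

Definition shifted_binom_moment m (a : nat) : R :=
  \sum_(k < m.+1) 'C(m, k)%:R * shifted_moment k (m - k) a.

Lemma shifted_binom_moment_odd p : exists2 C : R, 0 <= C &
  forall m, (0 < m)%N ->
  `|shifted_binom_moment m (2 * p).+1 - m%:R ^+ p * (2 ^+ p * p`!%:R) * (2 * mode_sum m p.+1)|
  <= C * m%:R ^+ p.
Proof.
have [C C0 HC] := binom_moment_odd p.
have [D D0 HD] := binom_moment_even_bound p.
pose K : R := (2 * p).+1%:R * 2 ^+ (2 * p).
have K0 : 0 <= K by rewrite mulr_ge0// exprn_ge0.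
exists (K * (D + 1) + C); first by rewrite addr_ge0// mulr_ge0// addr_ge0.
move=> m m0; rewrite -(subrKA (binom_moment m (2 * p).+1 0)).
apply: le_trans (ler_normD _ _) _; rewrite [leRHS]mulrDl lerD ?HC//.
apply: (@le_trans _ _ (K * (binom_moment m (2 * p) 0 + binom_moment m 0 0))).
  rewrite /shifted_binom_moment /binom_moment -sumrB -big_split mulr_sumr/=.
  apply: le_trans (ler_norm_sum _ _ _) _; apply: ler_sum => k _.
  rewrite -mulrBr -mulrDr normrM ger0_norm// [leRHS]mulrCA ler_wpM2l//.
  exact: shifted_moment_dist.
rewrite -mulrA ler_wpM2l// mulrDl mul1r lerD ?HD// binom_moment00.
by rewrite exprn_ege1// ler1n.
Qed.

End Moments.

(** * The Gamma function at half-integers *)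

Section GammaFunction.
Context {R : realType}.
Notation mu := (@lebesgue_measure R).
Implicit Types (x t : R) (k n : nat).

Definition gamma_fun x t : R := t `^ (x - 1) * expR (- t).

Lemma gamma_fun_ge0 x t : 0 <= gamma_fun x t.
Proof. by rewrite mulr_ge0 ?powR_ge0 ?expR_ge0. Qed.

Lemma measurable_gamma_fun x (D : set R) : measurable_fun D (gamma_fun x).
Proof.
apply: measurable_funTS; apply: measurable_funM.
  exact: measurable_powR.
by apply: measurableT_comp => //; exact: measurableT_comp.
Qed.

Lemma is_derive_gamma_fun x t : 0 < t ->
  is_derive t 1 (gamma_fun (x + 1)) (x * gamma_fun x t - gamma_fun (x + 1) t).
Proof.
move=> t0; rewrite /gamma_fun.
have -> : (fun t => t `^ (x + 1 - 1) * expR (- t)) = (fun t : R => t `^ x) * (fun t : R => expR (- t)).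
  by apply/funext => s /=; rewrite addrK.
have d1 : is_derive t 1 (fun t : R => t `^ x) (x * t `^ (x - 1)).
  exact: is_derive1_powR.
have d2 : is_derive t 1 (fun t : R => expR (- t)) (- expR (- t)).
  have := @is_derive1_comp R expR -%R t (expR (- t)) (-1) _ _.
  by rewrite mulrN1; apply.
apply: is_derive_eq; rewrite /GRing.scale/= addrK; ring.
Qed.

Lemma gamma_fun_continuous x t : 0 < t -> {for t, continuous (gamma_fun x)}.
Proof.
move=> t0; apply/differentiable_continuous/derivable1_diffP.
by rewrite -(subrK 1 x); have [] := is_derive_gamma_fun (x - 1) t t0.
Qed.

(** Compact intervals exhausting the half-line: integration by parts takes place on them, and
    monotone convergence passes to the limit. The shift by 2 keeps them nondegenerate from [n = 0]
    on. *)
Definition gamma_itv n : set R := `[n.+2%:R^-1, n.+2%:R]%classic.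

Lemma gamma_by_parts x n :
  (\int[mu]_(t in gamma_itv n) (x * gamma_fun x t)%:E =
   \int[mu]_(t in gamma_itv n) (gamma_fun (x + 1) t)%:E +
   (gamma_fun (x + 1) n.+2%:R - gamma_fun (x + 1) n.+2%:R^-1)%:E)%E.
Proof.
have n0 : 0 < n.+2%:R^-1 :> R by rewrite invr_gt0.
have nn : n.+2%:R^-1 < n.+2%:R :> R.
  by rewrite (@lt_trans _ _ 1)// ?ltr1n// invf_lt1// ltr1n.
have pos t : `[n.+2%:R^-1, n.+2%:R]%classic t -> 0 < t.
  by rewrite /= in_itv/= => /andP[h _]; exact: lt_le_trans h.
have cont y : {within `[n.+2%:R^-1, n.+2%:R], continuous (gamma_fun y)}.
  apply: continuous_in_subspaceT => t; rewrite inE => /pos t0.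
  exact: gamma_fun_continuous.
have int y : mu.-integrable (gamma_itv n) (EFin \o gamma_fun y).
  by apply: continuous_compact_integrable => //; exact: segment_compact.
have contx : {within `[n.+2%:R^-1, n.+2%:R], continuous (fun t => x * gamma_fun x t)}.
  apply: continuous_in_subspaceT => t; rewrite inE => /pos t0.
  by apply: cvgM; [exact: cvg_cst|exact: gamma_fun_continuous].
have intx : mu.-integrable (gamma_itv n) (EFin \o (fun t => x * gamma_fun x t)).
  by apply: continuous_compact_integrable => //; exact: segment_compact.
have := @continuous_FTC2 R (fun t => x * gamma_fun x t - gamma_fun (x + 1) t)
  (gamma_fun (x + 1)) _ _ nn.
rewrite -EFinB => <-.
- under [X in _ = (_ + X)%E]eq_integral do rewrite EFinB.
  rewrite integralB_EFin// addeC subeK//.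
  by rewrite integrable_fin_num//; exact: int.
- move=> t; apply: cvgB; [exact: contx|exact: cont].
- split.
  + by move=> t /subset_itv_oo_cc /pos t0; have [] := is_derive_gamma_fun x t t0.
  + by apply/cvg_at_right_filter/gamma_fun_continuous.
  + by apply/cvg_at_left_filter/gamma_fun_continuous; rewrite (lt_trans n0).
- move=> t /subset_itv_oo_cc /pos t0; rewrite derive1E.
  by have [_ ->] := is_derive_gamma_fun x t t0.
Qed.

Lemma bigcup_gamma_itv : \bigcup_n gamma_itv n = `]0, +oo[%classic.
Proof.
apply/seteqP; split=> t.
  by move=> [n _]; rewrite /gamma_itv /= !in_itv/= andbT => /andP[h _]; apply: lt_le_trans h.
rewrite /= in_itv/= andbT => t0.
pose N := maxn (Num.truncn t) (Num.truncn t^-1).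
exists N => //; rewrite /gamma_itv /= in_itv/=.
have tN (y : R) : 0 < y -> (Num.truncn y <= N)%N -> y <= N.+2%:R.
  move=> y0 yN; apply: le_trans (ltW (truncnS_gt y)) _.
  by rewrite ler_nat; exact: leq_trans (leqnSn _).
rewrite tN ?leq_maxl// andbT -[t]invrK lef_pV2 ?posrE ?invr_gt0//.
by rewrite tN ?invr_gt0// leq_maxr.
Qed.

Lemma nondecreasing_gamma_itv : nondecreasing_seq gamma_itv.
Proof.
move=> n m nm; apply/subsetPset; rewrite /gamma_itv; apply: subset_itv; rewrite bnd_simp.
  by rewrite lef_pV2 ?posrE// ler_nat !ltnS.
by rewrite ler_nat !ltnS.
Qed.

(** Extended-real valued, since the functional equation and the AM-GM bound can be proved before
    convergence is known; finiteness is then deduced from them. *)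
Definition egamma x : \bar R := (\int[mu]_(t in `]0%R, +oo[) (gamma_fun x t)%:E)%E.

Lemma gamma_fun_cvgy x : gamma_fun x n.+2%:R @[n --> \oo] --> (0 : R).
Proof.
have [j xj] : exists j, x - 1 <= j%:R :> R.
  by exists (Num.truncn (x - 1)).+1; apply/ltW/truncnS_gt.
apply: (@squeeze_cvgr _ _ _ _ (cst 0) (fun n => j.+1`!%:R * n.+2%:R^-1)).
- near=> n; rewrite /= gamma_fun_ge0/= /gamma_fun expRN.
  have n0 : 0 < n.+2%:R :> R by [].
  rewrite ler_pdivrMr ?expR_gt0//.
  have h1 : n.+2%:R `^ (x - 1) <= n.+2%:R ^+ j :> R.
    by rewrite -powR_mulrn//; apply: ler_powR => //; rewrite ler1n.
  apply: (le_trans h1).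
  (* The exponential dominates [t^(j+1) / (j+1)!], and [t^(x-1) <= t^j] for [t >= 1], so the
     integrand is at most [(j+1)! / t]. *)
  have := @expR_ge1Dxn R n.+2%:R j (ltW n0).
  set f := j.+1`!%:R; have f0 : 0 < f by rewrite ltr0n fact_gt0.
  move=> /(le_trans (_ : _ <= _)) h; rewrite mulrAC ler_pdivlMr// -exprSr mulrC.
  rewrite -ler_pdivrMr//; apply: h; lra.
- exact: cvg_cst.
- rewrite -[X in _ --> X](mulr0 (j.+1`!%:R)); apply: cvgM; first exact: cvg_cst.
  by move: (@cvg_harmonic R); rewrite -cvg_shiftS.
Unshelve. all: by end_near. Qed.

Lemma gamma_fun_cvg0 x : 0 < x -> gamma_fun (x + 1) n.+2%:R^-1 @[n --> \oo] --> (0 : R).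
Proof.
move=> x0.
have : t `^ x * expR (- t) @[t --> (0 : R)^'+] --> (0 : R).
  rewrite -[X in _ --> X](mul0r (expR (- 0))); apply: cvgM; first exact: powR_cvg0.
  apply: cvg_at_right_filter.
  by apply: (continuous_comp (f := -%R)); [exact: opp_continuous|exact: continuous_expR].
move/cvg_at_rightP => /(_ (fun n => n.+2%:R^-1)) h.
rewrite /gamma_fun addrK; apply: h; split=> [n|]; first by rewrite invr_gt0.
by move: (@cvg_harmonic R); rewrite -cvg_shiftS.
Qed.

(** Limit of [gamma_by_parts] along [gamma_itv]: the integrals converge monotonically and both
    boundary terms tend to 0, the one at 0 because [0 < x]. *)
Lemma egammaS x : 0 < x -> egamma (x + 1) = (x%:E * egamma x)%E.
Proof.
move=> x0; rewrite /egamma -ge0_integralZl//; last 3 first.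
- by apply/measurable_EFinP; exact: measurable_gamma_fun.
- by move=> t _; rewrite lee_fin gamma_fun_ge0.
- by rewrite lee_fin ltW.
rewrite -!bigcup_gamma_itv.
have c f : (forall t, 0 <= f t)%E -> measurable_fun setT f ->
    (\int[mu]_(t in gamma_itv n) f t)%E @[n --> \oo] -->
    (\int[mu]_(t in \bigcup_n gamma_itv n) f t)%E.
  move=> f0 mf; apply: ge0_nondecreasing_set_cvg_integral => //.
  - exact: nondecreasing_gamma_itv.
  - by move=> i; rewrite /gamma_itv.
  - by move=> i; exact: measurable_funTS.
have c3 : ((\int[mu]_(t in gamma_itv n) (gamma_fun (x + 1) t)%:E +
   (gamma_fun (x + 1) n.+2%:R - gamma_fun (x + 1) n.+2%:R^-1)%:E)%E) @[n --> \oo] -->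
   (\int[mu]_(t in \bigcup_n gamma_itv n) (gamma_fun (x + 1) t)%:E + (0 - 0)%:E)%E.
  apply: cvgeD.
  - by rewrite fin_num_adde_defl.
  - apply: c => [t|]; first by rewrite lee_fin gamma_fun_ge0.
    by apply/measurable_EFinP; exact: measurable_gamma_fun.
  - apply: cvg_EFin; first exact: nearW.
    apply: cvgB; [exact: gamma_fun_cvgy|exact: gamma_fun_cvg0].
have c4 : (\int[mu]_(t in gamma_itv n) (x%:E * (gamma_fun x t)%:E))%E @[n --> \oo]
    --> (\int[mu]_(t in \bigcup_n gamma_itv n) (gamma_fun (x + 1) t)%:E)%E.
  rewrite subr0 adde0 in c3; apply: cvg_trans c3; apply: near_eq_cvg.
  apply: nearW => n; rewrite -gamma_by_parts.
  by apply: eq_integral => t _; rewrite EFinM.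
symmetry; apply: cvg_unique c4 => //.
apply: c => [t|].
  by rewrite mule_ge0 ?lee_fin ?gamma_fun_ge0// ltW.
apply: measurable_funeM; apply/measurable_EFinP; exact: measurable_gamma_fun.
Qed.

Lemma egamma1 : egamma 1 = 1%:E.
Proof.
rewrite /egamma.
under eq_integral do rewrite /gamma_fun subrr powRr0 mul1r.
rewrite integral_itv_obnd_cbnd; last first.
  by apply/measurable_EFinP; apply: measurableT_comp => //; exact: measurableT_comp.
rewrite -(@integral_exponential_pdf R 1 ltr01) integral_mkcond.
apply: eq_integral => t _; rewrite /exponential_pdf !patchE; case: ifP => // _.
by rewrite mul1r mulN1r.
Qed.

Lemma GammaE x : Gamma x = fine (egamma x).
Proof. by []. Qed.

Lemma egamma_nat k : egamma k.+1%:R = k`!%:R%:E.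
Proof.
elim: k => [|k IH]; first exact: egamma1.
by rewrite -natr1 egammaS// IH -EFinM -natrM -factS.
Qed.

(* AM-GM under the integral sign. *)
Lemma egamma_amgm x (l : R) : 0 < l ->
  (2%:E * egamma (x + 2^-1) <= l%:E * egamma x + l^-1%:E * egamma (x + 1))%E.
Proof.
move=> l0; rewrite /egamma.
have me y : measurable_fun (`]0%R, +oo[%classic : set R) (EFin \o gamma_fun y).
  by apply/measurable_EFinP; exact: measurable_gamma_fun.
have ge0 y t : (0 <= (gamma_fun y t)%:E)%E by rewrite lee_fin gamma_fun_ge0.
rewrite -!ge0_integralZl//; try exact: me; try by rewrite lee_fin ?invr_ge0 ltW.
rewrite -ge0_integralD//; last 4 first.
- by move=> t _; rewrite mule_ge0// lee_fin ltW.
- by apply: measurable_funeM; exact: me.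
- by move=> t _; rewrite mule_ge0// lee_fin invr_ge0 ltW.
- by apply: measurable_funeM; exact: me.
apply: ge0_le_integral => //.
- by move=> t _; rewrite mule_ge0.
- by apply: measurable_funeM; exact: me.
- by apply: emeasurable_funD; apply: measurable_funeM; exact: me.
move=> t; rewrite /= in_itv/= andbT => t0.
rewrite -!EFinM -EFinD lee_fin /gamma_fun !mulrA -mulrDl ler_wpM2r ?expR_ge0//.
have t0' := ltW t0; have tn0 : t != 0 by rewrite gt_eqF.
have -> : t `^ (x + 2^-1 - 1) = t `^ (x - 1) * Num.sqrt t.
  by rewrite addrAC [t `^ (x - 1 + _)]powRD ?tn0 ?implybT// powR12_sqrt.
have -> : t `^ (x + 1 - 1) = t `^ (x - 1) * t.
  by rewrite addrAC [t `^ (x - 1 + _)]powRD ?tn0 ?implybT// powRr1.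
have := powR_ge0 t (x - 1); move: (t `^ _) => P P0.
move: (Num.sqrt t) (sqr_sqrtr t0') => r E; rewrite -E -subr_ge0.
have -> : l * P + l^-1 * (P * r ^+ 2) - 2 * (P * r) = l^-1 * (P * (l - r) ^+ 2).
  by field; rewrite gt_eqF.
apply: mulr_ge0; first by rewrite invr_ge0 ltW.
by apply: mulr_ge0 => //; exact: sqr_ge0.
Qed.

Lemma egamma_ge0 x : (0 <= egamma x)%E.
Proof. by apply: integral_ge0 => t _; rewrite lee_fin gamma_fun_ge0. Qed.

(** AM-GM bounds the value at [j + 3/2] by the values at [j + 1] and [j + 2], which are factorials.
    Finiteness at [1/2] then follows from the functional equation, whose factor [1/2] is
    positive. *)
Lemma egamma_half_fin k : egamma (k%:R + 2^-1) \is a fin_num.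
Proof.
have h j : egamma (j.+1%:R + 2^-1) \is a fin_num.
  rewrite ge0_fin_numE ?egamma_ge0//.
  have := egamma_amgm j.+1%:R 1 ltr01.
  rewrite natr1 !egamma_nat -!EFinM -EFinD => H.
  rewrite -(@lte_pmul2l _ 2%:E)// ?lte_fin//.
  by apply: (le_lt_trans H); rewrite gt0_muley ?ltry// lte_fin.
case: k => [|k]; last exact: h.
have := h 0%N; rewrite add0r addrC egammaS ?invr_gt0//.
have := egamma_ge0 2^-1; case: (egamma _) => [r _ _|_|]//.
by rewrite gt0_muley// lte_fin invr_gt0.
Qed.

Lemma GammaS_half k :
  Gamma (k.+1%:R + 2^-1) = (k%:R + 2^-1) * Gamma (k%:R + 2^-1) :> R.
Proof.
have k0 : 0 < k%:R + 2^-1 :> R by rewrite ltr_wpDl// invr_gt0.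
by rewrite !GammaE -natr1 addrAC egammaS// fineM// egamma_half_fin.
Qed.

(** The weight [sqrt (k + 1)] in [egamma_amgm] balances the two terms on the right, because
    consecutive factorials have ratio [k + 1]; this optimal choice recovers log-convexity. *)
Lemma Gamma_half_le k : Gamma (k.+1%:R + 2^-1) <= Num.sqrt k.+1%:R * k`!%:R :> R.
Proof.
have s0 : 0 < Num.sqrt k.+1%:R :> R by rewrite sqrtr_gt0.
have := egamma_amgm k.+1%:R _ s0.
rewrite natr1 !egamma_nat -(fineK (egamma_half_fin k.+1)) -GammaE -!EFinM -EFinD lee_fin.
have E : Num.sqrt k.+1%:R ^+ 2 = k.+1%:R :> R by rewrite sqr_sqrtr.
have -> : (Num.sqrt k.+1%:R)^-1 * k.+1`!%:R = Num.sqrt k.+1%:R * k`!%:R :> R.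
  rewrite factS natrM; move: (Num.sqrt _) s0 E => s s0 <-.
  by field; rewrite gt_eqF.
lra.
Qed.

(** The same AM-GM half a step further, with the integer [k + 2] now in the middle and the optimal
    weight [sqrt (k + 3/2)]. *)
Lemma Gamma_half_ge k :
  k.+1`!%:R <= Num.sqrt (k.+1%:R + 2^-1) * Gamma (k.+1%:R + 2^-1) :> R.
Proof.
have k0 : 0 < k.+1%:R + 2^-1 :> R by rewrite ltr_wpDl// invr_gt0.
have s0 : 0 < Num.sqrt (k.+1%:R + 2^-1) :> R by rewrite sqrtr_gt0.
have := egamma_amgm (k.+1%:R + 2^-1) _ s0.
have -> : k.+1%:R + 2^-1 + 2^-1 = k.+2%:R :> R by rewrite -[k.+2%:R]natr1; lra.
rewrite egamma_nat egammaS// -(fineK (egamma_half_fin k.+1)) -GammaE -!EFinM -EFinD lee_fin.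
have E : Num.sqrt (k.+1%:R + 2^-1) ^+ 2 = k.+1%:R + 2^-1 :> R by rewrite sqr_sqrtr// ltW.
move: (Gamma _) => G; move: (Num.sqrt _) s0 E => s s0 <-.
have -> : s^-1 * (s ^+ 2 * G) = s * G by field; rewrite gt_eqF.
lra.
Qed.

Lemma Gamma_half_gt0 k : 0 < Gamma (k%:R + 2^-1) :> R.
Proof.
have k0 : 0 < k%:R + 2^-1 :> R by rewrite ltr_wpDl// invr_gt0.
rewrite -(pmulr_rgt0 _ k0) -GammaS_half.
have := Gamma_half_ge k; have f0 : 0 < k.+1`!%:R :> R by rewrite ltr0n fact_gt0.
move=> /(lt_le_trans f0); rewrite pmulr_rgt0// sqrtr_gt0 ltr_wpDl// invr_gt0//.
Qed.

End GammaFunction.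

(** * Stirling's formula *)

Section Stirling.
Context {R : realType}.
Implicit Types (x y z : R) (k m n p q : nat).

Lemma ln_le_subr1 z : 0 < z -> ln z <= z - 1.
Proof. by move=> z0; have := expR_ge1Dx (ln z); rewrite lnK ?posrE//; lra. Qed.

Lemma ger_of_is_derive (f df : R -> R) y z : y <= z ->
  (forall x, y <= x -> is_derive x 1 f (df x)) ->
  (forall x, y <= x -> 0 <= df x) -> f y <= f z.
Proof.
rewrite le_eqVlt => /predU1P[->//|yz] dfE df0.
have [] := @MVT R f df y z yz.
- by move=> x; rewrite in_itv/= => /andP[/ltW yx _]; exact: dfE.
- apply: derivable_within_continuous => x; rewrite in_itv/= => /andP[yx _].
  by have [] := dfE x yx.
move=> c; rewrite in_itv/= => /andP[/ltW yc _] E; rewrite -subr_ge0 E.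
by rewrite mulr_ge0 ?df0// subr_ge0 ltW.
Qed.

(** This bound and [ln_upper] both agree with [ln] to second order at 1. That precision makes the
    increments of [stirling_log] of order [1 / k^2], hence summable. *)
Lemma ln_lower z : 1 <= z -> 2 * (z - 1) <= (z + 1) * ln z.
Proof.
move=> z1; rewrite -subr_ge0.
pose f := ((id + cst 1) * @ln R - cst 2 * (id - cst 1)).
have f1 : f 1 = 0 by rewrite /f !fctE ln1; ring.
rewrite -[X in _ <= X]/(f z) -f1.
apply: (ger_of_is_derive f (fun x => ln x + x^-1 - 1)) => // x x1.
  have x0 : 0 < x by exact: lt_le_trans x1.
  have dl : is_derive x 1 (@ln R) x^-1 by exact: is_derive1_ln.
  apply: is_derive_eq; rewrite /GRing.scale/= !fctE; field; rewrite gt_eqF//.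
have x0 : 0 < x by exact: lt_le_trans x1.
have := ln_le_subr1 x^-1; rewrite invr_gt0 => /(_ x0); rewrite lnV ?posrE//; lra.
Qed.

Lemma ln_upper z : 1 <= z -> 2 * z * ln z <= z ^+ 2 - 1.
Proof.
move=> z1; rewrite -subr_ge0.
pose f := (id ^+ 2 - cst 1 - cst 2 * id * @ln R) : R -> R.
have f1 : f 1 = 0 by rewrite /f !fctE ln1; ring.
rewrite -[X in _ <= X]/(f z) -f1.
apply: (ger_of_is_derive f (fun x => 2 * (x - 1 - ln x))) => // x x1.
  have x0 : 0 < x by exact: lt_le_trans x1.
  have dl : is_derive x 1 (@ln R) x^-1 by exact: is_derive1_ln.
  apply: is_derive_eq; rewrite /GRing.scale/= !fctE; field; rewrite gt_eqF//.
have x0 : 0 < x by exact: lt_le_trans x1.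
by have := ln_le_subr1 x x0; lra.
Qed.

Definition stirling_log k : R :=
  ln k`!%:R + k%:R - k%:R * ln k%:R - ln k%:R / 2.

(** The decrease equals [(k + 1/2) ln (1 + 1/k) - 1]. The logarithm bounds at [z = 1 + 1/k] place it
    between 0 and [1 / (4 k (k + 1))], which telescopes. *)
Lemma stirling_log_step k : (0 < k)%N ->
  0 <= stirling_log k - stirling_log k.+1 <= (k%:R^-1 - k.+1%:R^-1) / 4.
Proof.
move=> k0; have x0 : 0 < k%:R :> R by rewrite ltr0n.
rewrite /stirling_log factS natrM lnM ?posrE ?ltr0n ?fact_gt0//.
rewrite -[k.+1%:R]natr1; move: (ln k`!%:R) (k%:R) x0 => F x x0.
have x10 : 0 < x + 1 by lra.
have z1 : 1 <= (x + 1) / x by rewrite ler_pdivlMr//; lra.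
have := ln_lower _ z1; have := ln_upper _ z1.
rewrite ln_div ?posrE//; set y := ln (x + 1) - ln x => U L.
have -> : F + x - x * ln x - ln x / 2 -
    (ln (x + 1) + F + (x + 1) - (x + 1) * ln (x + 1) - ln (x + 1) / 2) =
    (x + 2^-1) * y - 1 by rewrite /y; field.
have xn0 : x != 0 by rewrite gt_eqF.
have L' : 2 <= (2 * x + 1) * y.
  move: L; rewrite -(ler_pM2r x0).
  have -> : 2 * ((x + 1) / x - 1) * x = 2 by field.
  by have -> : ((x + 1) / x + 1) * y * x = (2 * x + 1) * y by field.
have U' : 2 * x * (x + 1) * y <= 2 * x + 1.
  move: U; rewrite -(ler_pM2r (mulr_gt0 x0 x0)).
  have -> : 2 * ((x + 1) / x) * y * (x * x) = 2 * x * (x + 1) * y by field.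
  by have -> : (((x + 1) / x) ^+ 2 - 1) * (x * x) = 2 * x + 1 by field.
apply/andP; split; first lra.
rewrite -(ler_pM2r (mulr_gt0 x0 x10)).
have -> : (x^-1 - (x + 1)^-1) / 4 * (x * (x + 1)) = 4^-1.
  by field; rewrite gt_eqF//= gt_eqF.
have : (2 * x + 1) * (2 * x * (x + 1) * y) <= (2 * x + 1) * (2 * x + 1).
  by rewrite ler_wpM2l//; lra.
have -> : ((x + 2^-1) * y - 1) * (x * (x + 1)) =
  4^-1 * ((2 * x + 1) * (2 * x * (x + 1) * y)) - x * (x + 1) by field.
lra.
Qed.

(** [stirling_log] decreases while [stirling_log k - 1 / (4 k)] increases, so every value of the
    second sequence lies below every value of the first. *)
Lemma stirling_log_bound j k : (0 < j)%N -> (0 < k)%N ->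
  stirling_log j - j%:R^-1 / 4 <= stirling_log k.
Proof.
have dec i n : (0 < i)%N -> stirling_log (i + n) <= stirling_log i.
  move=> i0; elim: n => [|n IH]; first by rewrite addn0.
  apply: le_trans IH; rewrite addnS.
  by have /andP[] := stirling_log_step (i + n) (ltn_addr _ i0); lra.
have inc i n : (0 < i)%N ->
    stirling_log i - i%:R^-1 / 4 <= stirling_log (i + n) - (i + n)%:R^-1 / 4.
  move=> i0; elim: n => [|n IH]; first by rewrite addn0.
  apply: (le_trans IH); rewrite addnS.
  have /andP[_] := stirling_log_step (i + n) (ltn_addr _ i0).
  by move: ((i + n)%:R^-1) ((i + n).+1%:R^-1) => u v; lra.
move=> j0 k0; have [jk|kj] := leqP j k.
  rewrite (le_trans (inc j (k - j)%N j0))// subnKC//.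
  by rewrite gerBl divr_ge0.
have := dec k (j - k)%N k0; rewrite subnKC 1?ltnW// => h.
by rewrite (le_trans _ h)// gerBl divr_ge0.
Qed.

Definition stirling k : R := k`!%:R * expR k%:R / k%:R ^+ k.

Lemma stirling_gt0 k : 0 < stirling k.
Proof.
rewrite /stirling divr_gt0 ?mulr_gt0 ?expR_gt0 ?ltr0n ?fact_gt0//.
by case: k => [|k]; rewrite ?expr0// exprn_gt0.
Qed.

Lemma stirlingE k : (0 < k)%N -> stirling k = expR (stirling_log k) * Num.sqrt k%:R.
Proof.
move=> k0; have x0 : 0 < k%:R :> R by rewrite ltr0n.
rewrite /stirling_log /stirling !expRB !expRD lnK ?posrE ?ltr0n ?fact_gt0//.
rewrite expRM_natl lnK ?posrE//.
have -> : expR (ln k%:R / 2) = Num.sqrt k%:R :> R.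
  by rewrite -powR12_sqrt// /powR gt_eqF// mulrC.
by rewrite divfK// gt_eqF// sqrtr_gt0.
Qed.

Lemma stirling_formula : exists2 l : R, 0 < l & forall k, (0 < k)%N ->
  l * Num.sqrt k%:R <= stirling k <= l * Num.sqrt k%:R * (1 + k%:R^-1).
Proof.
(* The constant is the exponential of an infimum, so no convergence argument is needed. The index
   starts at 1 because [ln 0] is only a default value. *)
pose E := range (fun k => stirling_log k.+1).
have E0 : E !=set0 by exists (stirling_log 1), 0%N.
have lbE k : (0 < k)%N -> lbound E (stirling_log k - k%:R^-1 / 4).
  by move=> k0 _ [j _ <-]; exact: stirling_log_bound.
exists (expR (inf E)); first exact: expR_gt0.
move=> k k0; have x1 : 1 <= k%:R :> R by rewrite ler1n.
have xV : 0 < k%:R^-1 :> R by rewrite invr_gt0; lra.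
have xV1 : k%:R^-1 <= 1 :> R by rewrite invf_le1//; lra.
have s0 : 0 < Num.sqrt k%:R :> R by rewrite sqrtr_gt0; lra.
rewrite stirlingE// ler_pM2r// ler_expR.
have -> /= : inf E <= stirling_log k.
  apply: ge_inf; first by exists (stirling_log 1 - 1%:R^-1 / 4); exact: lbE.
  by exists k.-1 => //; rewrite prednK.
have h : stirling_log k <= inf E + k%:R^-1 / 4.
  by rewrite -lerBlDr; apply: lb_le_inf => //; exact: lbE.
rewrite [leRHS]mulrAC ler_pM2r//.
apply: (@le_trans _ _ (expR (inf E + k%:R^-1 / 4))); first by rewrite ler_expR.
rewrite expRD ler_pM2l ?expR_gt0//.
(* With [t = 1 / k <= 1]: [exp (t / 4) <= 1 / (1 - t / 4) <= 1 + t]. *)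
have := expR_ge1Dx (- (k%:R^-1 / 4) : R); rewrite expRN.
have := expR_gt0 (k%:R^-1 / 4 : R); move: xV xV1 (expR _).
move: (k%:R^-1 : R) => t t0 t1 e e0 H.
have : (1 - t / 4) * e <= 1 by rewrite -ler_pdivlMr//; lra.
nra.
Qed.

End Stirling.

(** * Coefficients of negative powers *)

Section RisingFactorial.
Context {R : realType}.
Implicit Types (x y : R) (k m n p q : nat).

(* The coefficients of the series of (1 - z)^(-x). *)
Fixpoint negbin x k : R :=
  if k is k'.+1 then negbin x k' * (x + k'%:R) / k'.+1%:R else 1.

Lemma negbinS x k : k.+1%:R * negbin x k.+1 = (x + k%:R) * negbin x k.
Proof. by rewrite /= [LHS]mulrC divfK ?pnatr_eq0// mulrC. Qed.

(** The Chu-Vandermonde identity. Multiplying by [m + 1 = k + (m + 1 - k)] and applying [negbinS] to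
    each factor is the coefficient form of differentiating the product of the two series. *)
Lemma negbin_conv x y m :
  \sum_(k < m.+1) negbin x k * negbin y (m - k) = negbin (x + y) m.
Proof.
elim: m => [|m IH]; first by rewrite big_ord1 /= mulr1.
apply: (@mulfI _ m.+1%:R); first by rewrite pnatr_eq0.
rewrite negbinS -IH !mulr_sumr.
transitivity (\sum_(k < m.+2) (k%:R * negbin x k * negbin y (m.+1 - k))
  + \sum_(k < m.+2) (negbin x k * ((m.+1 - k)%:R * negbin y (m.+1 - k)))).
  rewrite -big_split; apply: eq_bigr => k _ /=.
  have -> : m.+1%:R = k%:R + (m.+1 - k)%:R :> R by rewrite -natrD subnKC// -ltnS.
  by ring.
rewrite big_ord_recl /= !mul0r add0r [X in _ + X]big_ord_recr /= subnn mul0r mulr0 addr0.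
rewrite -big_split; apply: eq_bigr => k _ /=.
have km : (k <= m)%N by rewrite -ltnS.
have -> : bump 0 k = k.+1 by [].
rewrite subSS (subSn km) !negbinS.
have -> : (x + y + m%:R) = (x + k%:R) + (y + (m - k)%:R).
  by rewrite natrB//; ring.
by ring.
Qed.

Lemma negbin_nat n m : negbin n.+1%:R m * (m`!%:R * n`!%:R) = (m + n)`!%:R.
Proof.
elim: m => [|m IH]; first by rewrite /= mul1r mul1r add0n.
rewrite addSn !factS !natrM -IH.
have -> : (m + n).+1%:R = n.+1%:R + m%:R :> R by rewrite -natrD addSn addnC.
have := negbinS n.+1%:R m; move: (negbin _ m.+1) (negbin _ m) => u v.
move: (m`!%:R) (n`!%:R) (m.+1%:R) => a b c E.
rewrite [RHS]mulrA -E; ring.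
Qed.

Lemma fact_rise_bounds m n : (m ^ n * m`! <= (m + n)`! <= (m + n) ^ n * m`!)%N.
Proof.
elim: n => [|n /andP[IH1 IH2]]; first by rewrite !expn0 !mul1n addn0 leqnn.
rewrite addnS factS !expnS -!mulnA; apply/andP; split.
  by apply: leq_mul => //; rewrite leqW// leq_addr.
rewrite leq_mul2l/=; apply: (leq_trans IH2); rewrite leq_mul2r.
have [->|n0] := posnP n; first by rewrite !expn0 leqnn orbT.
by rewrite leq_exp2r// leqnSn orbT.
Qed.

Lemma expr_1Ddiv_bound (c : R) n : 0 <= c -> exists2 C : R, 0 <= C &
  forall k, (0 < k)%N -> (1 + c / k%:R) ^+ n <= 1 + C / k%:R.
Proof.
move=> c0; elim: n => [|n [C C0 IH]].
  by exists 0 => // k _; rewrite expr0 mul0r addr0.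
exists (C + c + C * c); first by rewrite !addr_ge0// mulr_ge0.
move=> k k0; have x0 : 0 < k%:R^-1 :> R by rewrite invr_gt0 ltr0n.
have x1 : k%:R^-1 <= 1 :> R by rewrite invf_le1 ?ltr0n// ler1n.
rewrite exprS; move: (k%:R^-1) x0 x1 (IH k k0) => t t0 t1 H.
apply: (@le_trans _ _ ((1 + c * t) * (1 + C * t))).
  by rewrite ler_wpM2l//; nra.
have : C * c * t * (1 - t) >= 0 by rewrite !mulr_ge0//; lra.
nra.
Qed.

End RisingFactorial.

(** * Stirling's constant *)

Section Asymptotics.
Context {R : realType}.
Implicit Types (x y : R) (k m n p q : nat).

Lemma ler_of_1Ddiv (a b c : R) : 0 <= b -> 0 <= c ->
  (forall k, (0 < k)%N -> a <= b * (1 + c / k%:R)) -> a <= b.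
Proof.
move=> b0 c0 H; rewrite leNgt; apply/negP => ab.
have d0 : 0 < a - b by rewrite subr_gt0.
pose k := (Num.truncn (b * c / (a - b))).+1.
have kR : b * c / (a - b) < k%:R by exact: truncnS_gt.
have k0 : 0 < k%:R :> R by rewrite ltr0n.
have := H k isT; rewrite mulrDr mulr1 mulrA -lerBlDl ler_pdivlMr// mulrC.
by move: kR; rewrite ltr_pdivrMr// ltNge => /negP.
Qed.

Lemma sqrt_le_1D (y x t : R) : 0 <= x -> 0 <= t -> y = x * (1 + t) ->
  Num.sqrt y <= Num.sqrt x * (1 + t).
Proof.
move=> x0 t0 ->; rewrite sqrtrM// ler_wpM2l ?sqrtr_ge0//.
have t1 : 0 <= 1 + t by rewrite addr_ge0.
rewrite -[leRHS]ger0_norm// -sqrtr_sqr ler_sqrt ?sqr_ge0//.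
by rewrite expr2 ler_peMl// lerDl.
Qed.

(** The duplication formula at half-integers. It serves twice: to identify Stirling's constant, and
    to cancel [Gamma (1/2)] in [sensor_constE]. *)
Lemma Gamma_half_fact k :
  Gamma (k%:R + 2^-1) * (4 ^+ k * k`!%:R) = (2 * k)`!%:R * Gamma 2^-1 :> R.
Proof.
elim: k => [|k IH]; first by rewrite muln0 fact0 expr0 !mul1r mulr1 add0r.
rewrite GammaS_half mulnS !factS !natrM -[(2 * k).+2%:R]natr1 -[(2 * k).+1%:R]natr1.
rewrite -[k.+1%:R]natr1 natrM exprS.
move: IH; move: (Gamma _) (Gamma _) (4 ^+ k) (k`!%:R) ((2 * k)`!%:R) => g G F f f2 IH.
have -> : (k%:R + 2^-1) * G * (4 * F * ((k%:R + 1) * f)) =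
   (2 * k%:R + 1 + 1) * (2 * k%:R + 1) * (G * (F * f)) by field.
by rewrite IH; ring.
Qed.

(** Exponentials and powers cancel exactly. Inserting [stirling k ~ l sqrt k] and
    [Gamma (k + 1/2) ~ k! / sqrt k] leaves [Gamma (1/2) * sqrt 2 * l = l^2], which determines
    [l]. *)
Lemma stirling_double k : (0 < k)%N ->
  Gamma 2^-1 * k`!%:R * stirling (2 * k) = Gamma (k%:R + 2^-1) * stirling k ^+ 2 :> R.
Proof.
move=> k0; have x0 : k%:R != 0 :> R by rewrite pnatr_eq0 -lt0n.
rewrite /stirling natrM expRM_natl exprMn.
have xk0 : k%:R ^+ k != 0 :> R by rewrite expf_neq0.
have -> : 2 ^+ (2 * k) = 4 ^+ k :> R by rewrite exprM; congr (_ ^+ k); ring.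
have -> : k%:R ^+ (2 * k) = (k%:R ^+ k) ^+ 2 :> R by rewrite mulnC exprM.
have F0 : 4 ^+ k != 0 :> R by rewrite expf_neq0.
apply: (mulIf F0).
transitivity ((2 * k)`!%:R * (Gamma 2^-1 : R) * (k`!%:R * expR k%:R ^+ 2 / (k%:R ^+ k) ^+ 2)).
  by field; rewrite xk0 F0.
by rewrite -Gamma_half_fact; field.
Qed.

Lemma stirling_constant (l : R) : 0 < l ->
  (forall k, (0 < k)%N ->
     l * Num.sqrt k%:R <= stirling k <= l * Num.sqrt k%:R * (1 + k%:R^-1)) ->
  l = Num.sqrt 2 * Gamma 2^-1.
Proof.
move=> l0 H; have g0 : 0 < Gamma 2^-1 :> R by rewrite -[2^-1]add0r; exact: (Gamma_half_gt0 0).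
have r0 : 0 < Num.sqrt 2 :> R by rewrite sqrtr_gt0.
(* [low] and [upp] are the two one-sided versions of this cancellation over plain reals, with
   [t = 1 / k]; the 3 comes from [(1 + t)^2 <= 1 + 3 t] on [[0, 1]]. *)
have low (G f S1 S2 s t : R) : 0 < G -> 0 < s -> 0 <= t <= 1 -> 0 <= S2 ->
    Gamma 2^-1 * f * S2 = G * S1 ^+ 2 -> l * s <= S1 ->
    S2 <= l * (Num.sqrt 2 * s) * (1 + t) -> f <= s * (1 + t) * G ->
    l <= Num.sqrt 2 * Gamma 2^-1 * (1 + 3 * t).
  move=> G0 s0 /andP[t0 t1] S20 E h1 h2 h3.
  move: (Num.sqrt 2) (Gamma _) r0 g0 E h2 => r g r0 g0 E h2.
  apply: (@le_trans _ _ (r * g * (1 + t) ^+ 2)); last by rewrite ler_pM2l ?mulr_gt0//; nra.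
  have D0 : 0 < G * l * s ^+ 2 by rewrite !mulr_gt0// exprn_gt0.
  rewrite -(ler_pM2l D0).
  have -> : G * l * s ^+ 2 * l = G * (l * s) ^+ 2 by ring.
  have -> : G * l * s ^+ 2 * (r * g * (1 + t) ^+ 2) =
    g * (s * (1 + t) * G) * (l * (r * s) * (1 + t)) by ring.
  apply: (@le_trans _ _ (G * S1 ^+ 2)).
    have ls0 : 0 <= l * s by rewrite ltW// mulr_gt0.
    by rewrite ler_pM2l// lerXn2r ?nnegrE// (le_trans ls0).
  have P0 : 0 <= l * (r * s) * (1 + t) by rewrite !mulr_ge0 ?addr_ge0// ltW.
  have P1 : 0 <= s * (1 + t) * G by rewrite !mulr_ge0 ?addr_ge0// ltW.
  rewrite -E (le_trans (ler_wpM2r S20 (ler_wpM2l (ltW g0) h3)))//.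
  by rewrite ler_wpM2l// mulr_ge0// ltW.
have upp (G f S1 S2 s t : R) : 0 < f -> 0 < s -> 0 <= t <= 1 -> 0 <= S1 ->
    Gamma 2^-1 * f * S2 = G * S1 ^+ 2 -> S1 <= l * s * (1 + t) ->
    l * (Num.sqrt 2 * s) <= S2 -> 0 <= G -> s * G <= f ->
    Num.sqrt 2 * Gamma 2^-1 <= l * (1 + 3 * t).
  move=> f0 s0 /andP[t0 t1] S10 E h1 h2 G0 h3.
  move: (Num.sqrt 2) (Gamma _) r0 g0 E h2 => r g r0 g0 E h2.
  apply: (@le_trans _ _ (l * (1 + t) ^+ 2)); last by rewrite ler_pM2l//; nra.
  have D0 : 0 < f * l * s by rewrite !mulr_gt0.
  rewrite -(ler_pM2l D0).
  have -> : f * l * s * (r * g) = g * f * (l * (r * s)) by ring.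
  have -> : f * l * s * (l * (1 + t) ^+ 2) = f * (l ^+ 2 * s * (1 + t) ^+ 2) by ring.
  apply: (@le_trans _ _ (g * f * S2)); first by rewrite ler_pM2l ?mulr_gt0.
  rewrite E; apply: (@le_trans _ _ (G * (l * s * (1 + t)) ^+ 2)).
    by rewrite ler_wpM2l// lerXn2r ?nnegrE// (le_trans S10).
  have -> : G * (l * s * (1 + t)) ^+ 2 = s * G * (l ^+ 2 * s * (1 + t) ^+ 2) by ring.
  by rewrite ler_wpM2r// !mulr_ge0 ?exprn_ge0 ?addr_ge0// ltW.
have S0 k : 0 <= stirling k :> R by rewrite ltW// stirling_gt0.
have k0 (k : nat) : 0 < k.+1%:R^-1 :> R by rewrite invr_gt0.
have k1 (k : nat) : 0 <= (k.+1%:R^-1 : R) <= 1.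
  by rewrite ltW//= invf_le1// ler1n.
have k2 (k : nat) : (2 * k.+1)%:R^-1 <= k.+1%:R^-1 :> R.
  by rewrite lef_pV2 ?posrE ?ltr0n ?muln_gt0// ler_nat leq_pmull.
have s2 (k : nat) : Num.sqrt (2 * k.+1)%:R = Num.sqrt 2 * Num.sqrt k.+1%:R :> R.
  by rewrite natrM sqrtrM.
have sk0 (k : nat) : 0 < Num.sqrt k.+1%:R :> R by rewrite sqrtr_gt0.
apply/eqP; rewrite eq_le; apply/andP; split.
- apply: (@ler_of_1Ddiv _ _ 3); rewrite ?mulr_ge0 ?ltW// => -[//|k] _.
  apply: (low (Gamma (k.+1%:R + 2^-1)) k.+1`!%:R (stirling k.+1) (stirling (2 * k.+1))
    (Num.sqrt k.+1%:R)) => //.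
  + exact: Gamma_half_gt0.
  + exact: stirling_double.
  + by have /andP[] := H k.+1 isT.
  + have /andP[_ h] := H (2 * k.+1)%N isT; rewrite s2 in h; apply: (le_trans h).
    by rewrite ler_wpM2l ?mulr_ge0 ?sqrtr_ge0 ?lerD2l// ltW.
  + apply: (le_trans (Gamma_half_ge k)); rewrite ler_wpM2r ?(ltW (Gamma_half_gt0 _))//.
    have := @sqrt_le_1D _ k.+1%:R k.+1%:R^-1 (ler0n _ _) (ltW (k0 k)) erefl.
    apply: le_trans; rewrite ler_sqrt; last by rewrite mulr_ge0// addr_ge0// ltW.
    by rewrite mulrDr mulr1 divff ?pnatr_eq0//; lra.
- apply: (@ler_of_1Ddiv _ _ 3); rewrite ?ltW// => -[//|k] _.
  apply: (upp (Gamma (k.+1%:R + 2^-1)) k.+1`!%:R (stirling k.+1) (stirling (2 * k.+1))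
    (Num.sqrt k.+1%:R)) => //.
  + exact: stirling_double.
  + by have /andP[] := H k.+1 isT.
  + by have /andP[h _] := H (2 * k.+1)%N isT; rewrite s2 in h.
  + exact/ltW/Gamma_half_gt0.
  + apply: le_trans (ler_wpM2l (sqrtr_ge0 _) (Gamma_half_le k)) _.
    by rewrite mulrA -expr2 sqr_sqrtr// factS natrM.
Qed.

Lemma stirling_bounds k : (0 < k)%N ->
  let l := Num.sqrt 2 * Gamma 2^-1 : R in
  (l * Num.sqrt k%:R <= stirling k) * (stirling k <= l * Num.sqrt k%:R * (1 + k%:R^-1)).
Proof.
move=> k0; have [l l0 H] := @stirling_formula R.
by rewrite /= -(stirling_constant l l0 H); have /andP[] := H k k0.
Qed.

End Asymptotics.

(** * Values of the weights at their modes *)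

Section ModeSum.
Context {R : realType}.
Implicit Types (x y : R) (k m n p q : nat).

Definition stirling_const : R := Num.sqrt 2 * Gamma 2^-1.
Local Notation ell := stirling_const.

Lemma stirling_const_gt0 : 0 < ell.
Proof.
rewrite mulr_gt0 ?sqrtr_gt0// -[2^-1]add0r; exact: (Gamma_half_gt0 0).
Qed.

Lemma sqrt_div_le1 k : Num.sqrt k%:R / k%:R <= 1 :> R.
Proof.
case: k => [|k]; first by rewrite invr0 mulr0.
rewrite ler_pdivrMr// mul1r -{2}(sqr_sqrtr (ler0n R k.+1)) expr2 ler_peMl ?sqrtr_ge0//.
by rewrite -[leLHS]sqrtr1 ler_sqrt// ler1n.
Qed.

Definition half_pow p k : R := k%:R ^+ p * Num.sqrt k%:R.

Lemma half_pow_ge0 p k : 0 <= half_pow p k.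
Proof. by rewrite mulr_ge0 ?exprn_ge0 ?sqrtr_ge0. Qed.

Lemma half_pow_div p k : half_pow p k / k%:R <= k%:R ^+ p.
Proof. by rewrite /half_pow -mulrA ler_piMr ?exprn_ge0 ?sqrt_div_le1. Qed.

Lemma half_powE p k : half_pow p k * Num.sqrt k%:R = k%:R ^+ p.+1.
Proof. by rewrite /half_pow -mulrA -expr2 sqr_sqrtr// exprSr. Qed.

Lemma half_pow_le p k m : (k <= m)%N -> half_pow p k <= half_pow p m.
Proof.
move=> km; apply: ler_pM; rewrite ?exprn_ge0 ?sqrtr_ge0//.
  by rewrite lerXn2r ?nnegrE// ler_nat.
by rewrite ler_sqrt// ler_nat.
Qed.

(** The binomial probability of [k] at its own mode [k / m] is [stirling m / (stirling k * stirling
    (m - k))]. Attaching the powers of [k / m] and [1 - k / m] to the matching factors makes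
    [mode_sum] a convolution of this sequence with itself. *)
Definition stirling_weight p k : R := k%:R ^+ p.+1 / stirling k.

Lemma stirling_weight_bound p k :
  `|stirling_weight p k - half_pow p k / ell| <= k%:R ^+ p / ell.
Proof.
have l0 := stirling_const_gt0.
have [->|k0] := posnP k.
  rewrite /stirling_weight /half_pow sqrtr0 exprS !mul0r mulr0 mul0r subrr normr0.
  by rewrite divr_ge0 ?exprn_ge0// ltW.
have [h1 h2] := @stirling_bounds R k k0; rewrite -/ell in h1 h2.
have x0 : 0 < k%:R :> R by rewrite ltr0n.
have s0 : 0 < Num.sqrt k%:R :> R by rewrite sqrtr_gt0.
have S0 := @stirling_gt0 R k.
rewrite /stirling_weight -half_powE.
have := half_pow_ge0 p k; have := half_pow_div p k.
move: (half_pow p k) (stirling k) (Num.sqrt _) S0 s0 h1 h2 => P S s S0 s0 h1 h2 Pk P0.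
have t0 : 0 < k%:R^-1 :> R by rewrite invr_gt0.
rewrite ler_norml; apply/andP; split; last first.
  apply: (@le_trans _ _ 0); last by rewrite divr_ge0 ?exprn_ge0// ltW.
  rewrite subr_le0 ler_pdivrMr// mulrAC ler_pdivlMr// -!mulrA ler_wpM2l//.
  by rewrite mulrC.
rewrite lerNl opprB.
apply: (@le_trans _ _ (P / k%:R / ell)); last by rewrite ler_pM2r ?invr_gt0.
rewrite lerBlDl -lerBlDr.
have -> : P / ell - P / k%:R / ell = P / ell * (1 - k%:R^-1) by field; rewrite !gt_eqF.
rewrite ler_pdivlMr//.
(* This is [(1 - t) (1 + t) <= 1] with [t = 1 / k]; the case [t >= 1] is split off so that the
   factor [1 - t] stays positive. *)
have Q : (1 - k%:R^-1) * S <= ell * s.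
  have [t1|t1] := lerP 1 (k%:R^-1 : R).
    apply: (@le_trans _ _ 0); last by rewrite mulr_ge0 ?ltW.
    by rewrite mulr_le0_ge0 ?subr_le0// ltW.
  apply: (@le_trans _ _ ((1 - k%:R^-1) * (ell * s * (1 + k%:R^-1)))).
    by rewrite ler_wpM2l// subr_ge0 ltW.
  have ls0 : 0 <= ell * s by rewrite mulr_ge0 ?ltW.
  by rewrite mulrCA ler_piMr//; nra.
rewrite -(mulrA (P / ell)); apply: (@le_trans _ _ (P / ell * (ell * s))); last first.
  by rewrite le_eqVlt; apply/orP; left; apply/eqP; field; rewrite gt_eqF.
by rewrite ler_wpM2l// divr_ge0// ltW.
Qed.

Lemma Gamma_negbin q k :
  Gamma (q%:R + 2^-1) * negbin (q%:R + 2^-1) k * k`!%:R = Gamma ((k + q)%:R + 2^-1) :> R.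
Proof.
elim: k => [|k IH]; first by rewrite /= !mulr1 add0n.
rewrite addSn GammaS_half -IH factS natrM.
rewrite mulrA -(mulrA (Gamma _)) (mulrC _ k.+1%:R) negbinS natrD; ring.
Qed.

(** By [Gamma_negbin] the first term is [Gamma (k + p + 3/2) / k!], which the half-integer bounds on
    Gamma and the rising factorial squeeze around [k^(p + 1/2)]. At [k = 0] the power [k ^ p] may
    vanish while the left side does not, hence the separate bound. *)
Lemma negbin_bound p : exists2 C : R, 0 <= C & forall k,
  `|Gamma (p.+1%:R + 2^-1) * negbin (p.+1%:R + 2^-1) k - half_pow p k| <=
  C * (if k is 0%N then 1 else k%:R ^+ p).
Proof.
have [C C0 HC] := @expr_1Ddiv_bound R p.+1%:R p.+1 (ler0n _ _).
have G0 := Gamma_half_gt0 (R := R) p.+1.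
exists (C + p.+2%:R + Gamma (p.+1%:R + 2^-1)).
  by rewrite !addr_ge0// ltW.
move=> [|k].
  rewrite /= !mulr1 /half_pow sqrtr0 mulr0 subr0 ger0_norm; last exact: ltW.
  by rewrite lerDr addr_ge0.
rewrite -[X in X - _](mulfK (_ : k.+1`!%:R != 0)) ?pnatr_eq0 -?lt0n ?fact_gt0//.
rewrite Gamma_negbin.
set j := (k.+1 + p.+1)%N; set G := Gamma _.
have f0 : 0 < k.+1`!%:R :> R by rewrite ltr0n fact_gt0.
have xn0 : k.+1%:R != 0 :> R by rewrite pnatr_eq0.
have x0 : 0 < k.+1%:R :> R by [].
have t0 : 0 < k.+1%:R^-1 :> R by rewrite invr_gt0.
have t1 : k.+1%:R^-1 <= 1 :> R by rewrite invf_le1// ler1n.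
have Pp := half_pow_ge0 p k.+1.
have jE : j%:R = k.+1%:R * (1 + p.+1%:R / k.+1%:R) :> R.
  by rewrite mulrDr mulr1 mulrCA divff// mulr1 natrD.
have /andP[F1 F2] := fact_rise_bounds k.+1 p.+1.
have {}F1 : k.+1%:R ^+ p.+1 * k.+1`!%:R <= j`!%:R :> R by rewrite -natrX -natrM ler_nat.
have {}F2 : j`!%:R <= j%:R ^+ p.+1 * k.+1`!%:R :> R by rewrite -natrX -natrM ler_nat.
have U : G / k.+1`!%:R <= half_pow p k.+1 * (1 + C / k.+1%:R).
  apply: (@le_trans _ _ (half_pow p j)); last first.
    rewrite /half_pow {1}jE exprMn.
    apply: (@le_trans _ _ (k.+1%:R ^+ p * (1 + p.+1%:R / k.+1%:R) ^+ p *
       (Num.sqrt k.+1%:R * (1 + p.+1%:R / k.+1%:R)))).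
      rewrite ler_wpM2l ?mulr_ge0 ?exprn_ge0 ?addr_ge0 ?divr_ge0//.
      by apply: sqrt_le_1D => //; rewrite divr_ge0.
    rewrite mulrACA -exprSr ler_wpM2l//; exact: HC.
  rewrite ler_pdivrMr//.
  have s0 : 0 < Num.sqrt j%:R :> R by rewrite sqrtr_gt0.
  rewrite -(ler_pM2r s0) mulrAC half_powE; apply: le_trans F2.
  have := Gamma_half_le (R := R) (k + p.+1)%N; rewrite -/j => /(ler_wpM2r (ltW s0)).
  by rewrite -addSn -/j mulrAC -expr2 sqr_sqrtr// -natrM -factS -addSn.
have L : half_pow p k.+1 * (1 - p.+2%:R / k.+1%:R) <= G / k.+1`!%:R.
  rewrite ler_pdivlMr//.
  have := Gamma_half_ge (R := R) (k + p.+1)%N; rewrite -addSn -/j -/G => H.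
  have Gp : 0 < G by exact: Gamma_half_gt0.
  (* Here [j + 1/2] exceeds [k.+1] by [p + 3/2], rounded up to [p + 2]. *)
  have Sq : Num.sqrt (j%:R + 2^-1) <= Num.sqrt k.+1%:R * (1 + p.+2%:R / k.+1%:R) :> R.
    have pk0 : 0 <= p.+2%:R / k.+1%:R :> R by rewrite divr_ge0.
    have := @sqrt_le_1D R _ k.+1%:R _ (ler0n _ _) pk0 erefl.
    apply: le_trans; rewrite ler_sqrt; last by rewrite mulr_ge0// addr_ge0.
    by rewrite mulrDr mulr1 mulrCA divff// mulr1 /j natrD -[p.+2%:R]natr1; lra.
  have s0 : 0 < Num.sqrt k.+1%:R :> R by rewrite sqrtr_gt0.
  have u0 : 0 <= p.+2%:R / k.+1%:R :> R by rewrite divr_ge0.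
  rewrite -(ler_pM2r s0); move: (p.+2%:R / k.+1%:R) u0 Sq => u u0 Sq.
  have -> : half_pow p k.+1 * (1 - u) * k.+1`!%:R * Num.sqrt k.+1%:R =
      k.+1%:R ^+ p.+1 * k.+1`!%:R * (1 - u).
    by rewrite -half_powE; ring.
  have Gs0 : 0 <= G * Num.sqrt k.+1%:R by rewrite mulr_ge0 ?ltW.
  have [u1|u1] := lerP 1 u.
    apply: (@le_trans _ _ 0) => //.
    by rewrite mulr_ge0_le0 ?subr_le0// mulr_ge0// exprn_ge0.
  have u2 : 0 <= 1 - u by rewrite subr_ge0 ltW.
  apply: le_trans (ler_wpM2r u2 F1) _.
  apply: le_trans (ler_wpM2r u2 H) _.
  apply: le_trans (ler_wpM2r u2 (ler_wpM2r (ltW Gp) Sq)) _.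
  have -> : Num.sqrt k.+1%:R * (1 + u) * G * (1 - u) = G * Num.sqrt k.+1%:R * (1 - u ^+ 2) by ring.
  by rewrite ler_piMr// gerBl sqr_ge0.
have Pk := half_pow_div p k.+1.
have xp : 0 <= k.+1%:R ^+ p :> R by rewrite exprn_ge0.
have {}U : G / k.+1`!%:R <= half_pow p k.+1 + C * k.+1%:R ^+ p.
  by apply: (le_trans U); rewrite mulrDr mulr1 lerD2l mulrCA ler_wpM2l.
have {}L : half_pow p k.+1 - p.+2%:R * k.+1%:R ^+ p <= G / k.+1`!%:R.
  by apply: le_trans L; rewrite mulrBr mulr1 lerD2l lerN2 mulrCA ler_wpM2l.
have := mulr_ge0 (ltW G0) xp; have := mulr_ge0 C0 xp.
have := mulr_ge0 (ler0n R p.+2) xp; rewrite (mulrDl (C + _)) (mulrDl C) ler_norml.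
move: (G / _) (half_pow p k.+1) (C * _) (p.+2%:R * _) (Gamma _ * _) U L.
by move=> g P u v w *; apply/andP; split; lra.
Qed.

Lemma mode_sumE m p : (0 < m)%N -> mode_sum m p.+1 =
  m%:R ^- (2 * p.+1) * stirling m *
  \sum_(k < m.+1) stirling_weight p k * stirling_weight p (m - k).
Proof.
move=> m0; have mn0 : m%:R != 0 :> R by rewrite pnatr_eq0 -lt0n.
rewrite mulr_sumr; apply: eq_bigr => k _.
have km : (k <= m)%N by rewrite -ltnS.
have pn0 i : i%:R ^+ i != 0 :> R by case: i => [|i]; rewrite ?expr0 ?oner_neq0// expf_neq0// pnatr_eq0.
have fn0 i : i`!%:R != 0 :> R by rewrite pnatr_eq0 -lt0n fact_gt0.
rewrite binom_polyE.
have -> : 1 - k%:R / m%:R = (m - k)%:R / m%:R :> R.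
  by rewrite natrB// mulrBl divff.
rewrite /stirling_weight /stirling.
have -> : expR m%:R = expR k%:R * expR (m - k)%:R :> R by rewrite -expRD -natrD subnKC.
have -> : m`!%:R = 'C(m, k)%:R * (k`!%:R * (m - k)`!%:R) :> R by rewrite -!natrM bin_fact.
have -> : m%:R ^+ m = m%:R ^+ k * m%:R ^+ (m - k) :> R by rewrite -exprD subnKC.
have -> : m%:R ^+ (2 * p.+1) = (m%:R ^+ p.+1) ^+ 2 :> R by rewrite mulnC exprM.
rewrite !exprMn !exprVn.
have e0 i : expR i%:R != 0 :> R by rewrite gt_eqF// expR_gt0.
have m1 i : m%:R ^+ i != 0 :> R by rewrite expf_neq0.
move: (pn0 k) (pn0 (m - k)%N) (fn0 k) (fn0 (m - k)%N) (e0 k) (e0 (m - k)%N) (m1 p.+1) (m1 k) (m1 (m - k)%N).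
move: (k%:R ^+ k) ((m - k)%:R ^+ (m - k)) (k`!%:R) ((m - k)`!%:R) (expR _) (expR _) (m%:R ^+ p.+1)
  (m%:R ^+ k) (m%:R ^+ (m - k)) (k%:R ^+ p.+1) ((m - k)%:R ^+ p.+1) ('C(m, k)%:R) => *.
by field; do ![apply/andP; split].
Qed.

End ModeSum.

(** * Asymptotics of the sum of the modal values *)

Section ModeSumAsymptotics.
Context {R : realType}.
Implicit Types (x y : R) (k m n p q : nat).
Local Notation ell := (@stirling_const R).

Lemma convolution_dist (A B : nat -> R) (D E : R) m : 0 <= D -> 0 <= E ->
  (forall k, (k <= m)%N -> `|A k - B k| <= D) ->
  (forall k, (k <= m)%N -> `|A k| <= E) -> (forall k, (k <= m)%N -> `|B k| <= E) ->
  `|\sum_(k < m.+1) A k * A (m - k)%N - \sum_(k < m.+1) B k * B (m - k)%N| <=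
  m.+1%:R * (2 * (D * E)).
Proof.
move=> D0 E0 AB AE BE; rewrite -sumrB; apply: le_trans (ler_norm_sum _ _ _) _.
rewrite [leRHS](_ : _ = \sum_(k < m.+1) (2 * (D * E))); last first.
  by rewrite sumr_const card_ord mulr_natl.
apply: ler_sum => k _; have km : (k <= m)%N by rewrite -ltnS.
have mk : (m - k <= m)%N by exact: leq_subr.
have -> : A k * A (m - k)%N - B k * B (m - k)%N =
  (A k - B k) * A (m - k)%N + (A (m - k)%N - B (m - k)%N) * B k by ring.
apply: le_trans (ler_normD _ _) _; rewrite !normrM mulr2n mulrDl !mul1r.
by apply: lerD; apply: ler_pM => //; [exact: AB|exact: AE|exact: AB|exact: BE].
Qed.

Lemma negbin_odd_bound n : exists2 C : R, 0 <= C & forall m, (0 < m)%N ->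
  1 <= negbin (n.+1%:R : R) m * n`!%:R / m%:R ^+ n <= 1 + C / m%:R.
Proof.
have [C C0 HC] := @expr_1Ddiv_bound R n%:R n (ler0n _ _).
exists C => // m m0; have x0 : 0 < m%:R :> R by rewrite ltr0n.
have f0 : 0 < m`!%:R :> R by rewrite ltr0n fact_gt0.
have -> : negbin n.+1%:R m * n`!%:R = (m + n)`!%:R / m`!%:R :> R.
  by rewrite -negbin_nat (mulrC m`!%:R) !mulrA mulfK// gt_eqF.
have /andP[F1 F2] := fact_rise_bounds m n.
have xn0 : 0 < m%:R ^+ n :> R by rewrite exprn_gt0.
apply/andP; split.
  by rewrite ler_pdivlMr// mul1r ler_pdivlMr// -natrX -natrM ler_nat.
apply: le_trans (HC m m0); rewrite ler_pdivrMr// ler_pdivrMr//.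
rewrite -exprMn mulrDl mul1r divfK ?gt_eqF// -natrD -natrX -natrM ler_nat.
done.
Qed.

(** Replacing the weights by series coefficients changes each factor by [O(m^p)] against a size
    [O(m^(p + 1/2))], so the convolution, of order [m^(2p + 2)], moves by [O(m^(2p + 3/2))]. The
    prefactor has order [m^(1/2 - 2p - 2)], which leaves a bounded error. *)
Lemma mode_sum_asymp p : exists2 C : R, 0 <= C & forall m, (0 < m)%N ->
  `|mode_sum m p.+1 - Gamma (p.+1%:R + 2^-1) ^+ 2 / (ell * (2 * p.+1)`!%:R) * Num.sqrt m%:R| <= C.
Proof.
have l0 : 0 < ell := stirling_const_gt0.
have [C C0 HC] := @negbin_bound R p.
have [D D0 HD] := negbin_odd_bound (2 * p.+1).
set G := Gamma (p.+1%:R + 2^-1) in HC *.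
have Gp : 0 < G by exact: Gamma_half_gt0.
set N := (2 * p.+1)%N in HD *.
have N0 : 0 < N`!%:R :> R by rewrite ltr0n fact_gt0.
pose x : R := p.+1%:R + 2^-1.
have x0 : 0 <= x by rewrite addr_ge0.
pose A := stirling_weight (R := R) p.
(* [B] shares the leading term [half_pow p k / ell] with [A], but its self-convolution is known
   exactly. As [x + x] is the integer [N + 1], that convolution is a ratio of factorials. *)
pose B k : R := G / ell * negbin x k.
pose DD := (C + 1) / ell; pose EE := (C + 2) / ell.
have DD0 : 0 <= DD by rewrite divr_ge0 ?addr_ge0// ltW.
have EE0 : 0 <= EE by rewrite divr_ge0 ?addr_ge0// ltW.
(* The 8 collects three factors 2: from [stirling m <= 2 ell sqrt m], from [m + 1 <= 2 m] and from
   [convolution_dist]. The second summand pays for the errors in [stirling m] and in the convolved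
   coefficient. *)
exists (8 * ell * DD * EE + G ^+ 2 / (ell * N`!%:R) * (1 + D + D)).
  have l0' := ltW l0; have lN : 0 <= ell * N`!%:R by exact: mulr_ge0.
  have ? : 0 <= 8 * ell * DD * EE by apply: mulr_ge0 => //; apply: mulr_ge0 => //; apply: mulr_ge0.
  have ? : 0 <= G ^+ 2 / (ell * N`!%:R) by rewrite divr_ge0 ?sqr_ge0.
  by rewrite addr_ge0// mulr_ge0// !addr_ge0.
move=> m m0; have y1 : 1 <= m%:R :> R by rewrite ler1n.
have y0 : 0 < m%:R :> R by rewrite ltr0n.
have s1 : 1 <= Num.sqrt m%:R :> R by rewrite -[leLHS]sqrtr1 ler_sqrt// ltW.
have mp0 : 0 <= m%:R ^+ p :> R by rewrite exprn_ge0.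
have kp k : (k <= m)%N -> k%:R ^+ p <= m%:R ^+ p :> R.
  by move=> km; rewrite lerXn2r ?nnegrE// ler_nat.
have hp k : (k <= m)%N -> half_pow (R := R) p k <= m%:R ^+ p * Num.sqrt m%:R.
  exact: half_pow_le.
have hB k : (k <= m)%N -> `|B k - half_pow p k / ell| <= C * m%:R ^+ p / ell.
  move=> km; have := HC k; rewrite -/x.
  have -> : B k - half_pow p k / ell = (G * negbin x k - half_pow p k) / ell.
    by rewrite /B; ring.
  move=> h; rewrite normrM [X in _ * X]ger0_norm ?invr_ge0 ?(ltW l0)// ler_pM2r ?invr_gt0//.
  apply: (le_trans h); rewrite ler_wpM2l//; case: k km {h} => [|k] km; last exact: kp.
  by rewrite exprn_ege1.
have hA k : (k <= m)%N -> `|A k - half_pow p k / ell| <= m%:R ^+ p / ell.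
  move=> km; apply: (le_trans (stirling_weight_bound p k)).
  by rewrite ler_pM2r ?invr_gt0// kp.
have AB k : (k <= m)%N -> `|A k - B k| <= DD * m%:R ^+ p.
  move=> km; rewrite -(subrKA (half_pow p k / ell)).
  apply: le_trans (ler_normD _ _) _; rewrite [X in _ + X]distrC.
  apply: (le_trans (lerD (hA k km) (hB k km))).
  by rewrite le_eqVlt; apply/orP; left; apply/eqP; rewrite /DD; ring.
have mps : m%:R ^+ p <= m%:R ^+ p * Num.sqrt m%:R :> R by rewrite ler_peMr.
have hpn k : (k <= m)%N -> `|half_pow (R := R) p k / ell| <= m%:R ^+ p * Num.sqrt m%:R / ell.
  move=> km; rewrite ger0_norm ?divr_ge0 ?half_pow_ge0 ?(ltW l0)//.
  by rewrite ler_pM2r ?invr_gt0// hp.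
have bd (u v c : R) : 0 <= c -> c <= C + 1 -> `|u - v| <= c * m%:R ^+ p / ell ->
   `|v| <= m%:R ^+ p * Num.sqrt m%:R / ell -> `|u| <= EE * (m%:R ^+ p * Num.sqrt m%:R).
  move=> c0 cC h1 h2; rewrite -(subrK v u).
  apply: le_trans (ler_normD _ _) _; apply: (le_trans (lerD h1 h2)).
  rewrite /EE -mulrDl [leRHS]mulrAC ler_pM2r ?invr_gt0//.
  apply: (@le_trans _ _ ((C + 1) * (m%:R ^+ p * Num.sqrt m%:R) + m%:R ^+ p * Num.sqrt m%:R)).
    by rewrite lerD2r; apply: ler_pM.
  by rewrite le_eqVlt; apply/orP; left; apply/eqP; ring.
have AE k : (k <= m)%N -> `|A k| <= EE * (m%:R ^+ p * Num.sqrt m%:R).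
  move=> km; apply: (bd _ (half_pow p k / ell) 1) => //; [by rewrite lerDr| |exact: hpn].
  by rewrite mul1r; exact: hA.
have BE k : (k <= m)%N -> `|B k| <= EE * (m%:R ^+ p * Num.sqrt m%:R).
  by move=> km; apply: (bd _ (half_pow p k / ell) C) => //; [rewrite lerDl|exact: hB|exact: hpn].
have conv := @convolution_dist A B _ _ m (mulr_ge0 DD0 mp0)
  (mulr_ge0 EE0 (mulr_ge0 mp0 (sqrtr_ge0 _))) AB AE BE.
have BB : \sum_(k < m.+1) B k * B (m - k)%N = (G / ell) ^+ 2 * negbin N.+1%:R m.
  have -> : N.+1%:R = x + x :> R by rewrite /x /N -natr1 natrM; lra.
  rewrite -negbin_conv mulr_sumr; apply: eq_bigr => k _; rewrite /B; ring.
rewrite mode_sumE// -/A -/N; rewrite BB in conv.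
have /andP[g1 g2] := HD m m0.
have [h1 h2] := @stirling_bounds R m m0; rewrite -/ell in h1 h2.
have ssE : Num.sqrt m%:R ^+ 2 = m%:R :> R by rewrite sqr_sqrtr// ltW.
have sm1 := @sqrt_div_le1 R m.
have mN : m%:R ^+ N = (m%:R ^+ p) ^+ 2 * m%:R ^+ 2 :> R.
  by rewrite /N mulnS exprD (mulnC 2 p) exprM mulrC.
have t1 : m%:R^-1 <= 1 :> R by rewrite invf_le1.
have t0 : 0 < m%:R^-1 :> R by rewrite invr_gt0.
have S0 : 0 < stirling m :> R by exact: stirling_gt0.
set SA := \sum_(k < m.+1) _ in conv *.
set nb := negbin N.+1%:R m in g1 g2 conv *.
have mNp : 0 < m%:R ^+ N :> R by rewrite exprn_gt0.
have -> : m%:R ^- N * stirling m * SA - G ^+ 2 / (ell * N`!%:R) * Num.sqrt m%:R =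
  m%:R ^- N * stirling m * (SA - (G / ell) ^+ 2 * nb) +
  G ^+ 2 / (ell * N`!%:R) * (stirling m / ell * (nb * N`!%:R / m%:R ^+ N) - Num.sqrt m%:R).
  by field; rewrite !gt_eqF.
apply: le_trans (ler_normD _ _) _; apply: lerD.
  rewrite normrM ger0_norm; last by rewrite mulr_ge0 ?invr_ge0// ltW.
  have st2 : stirling m <= 2 * (ell * Num.sqrt m%:R).
    have ls0 : 0 <= ell * Num.sqrt m%:R.
      by apply: mulr_ge0; [exact: ltW|exact: sqrtr_ge0].
    by apply: (le_trans h2); rewrite [leRHS]mulrC ler_wpM2l//; lra.
  have m2 : m.+1%:R <= 2 * m%:R :> R by rewrite -natr1; lra.
  apply: (@le_trans _ _ (m%:R ^- N * (2 * (ell * Num.sqrt m%:R)) *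
     (2 * m%:R * (2 * (DD * m%:R ^+ p * (EE * (m%:R ^+ p * Num.sqrt m%:R))))))).
    apply: ler_pM => //.
    - by rewrite mulr_ge0 ?invr_ge0// ltW.
    - by rewrite ler_wpM2l ?invr_ge0 ?(ltW mNp).
    apply: (le_trans conv); rewrite ler_wpM2r//.
    apply: mulr_ge0 => //; apply: mulr_ge0; first exact: mulr_ge0.
    by apply: mulr_ge0 => //; apply: mulr_ge0 => //; exact: sqrtr_ge0.
  rewrite le_eqVlt; apply/orP; left; apply/eqP; rewrite mN.
  have -> : (m%:R ^+ p) ^+ 2 * m%:R ^+ 2 = (m%:R ^+ p) ^+ 2 * (m%:R * Num.sqrt m%:R ^+ 2) :> R.
    by rewrite ssE.
  by field; rewrite !gt_eqF// ?exprn_gt0// sqrtr_gt0.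
have K0 : 0 <= G ^+ 2 / (ell * N`!%:R) by rewrite divr_ge0 ?sqr_ge0// mulr_ge0// ltW.
rewrite normrM ger0_norm// ler_wpM2l//.
have q1 : Num.sqrt m%:R <= stirling m / ell by rewrite ler_pdivlMr// mulrC.
have q2 : stirling m / ell <= Num.sqrt m%:R * (1 + m%:R^-1).
  by rewrite ler_pdivrMr// [leRHS]mulrC mulrA.
move: (stirling m / ell) (nb * _ / _) g1 g2 q1 q2 => u v g1 g2 q1 q2.
move: (Num.sqrt m%:R) (m%:R^-1) s1 t0 t1 sm1 q1 q2 g2 => s t s1 t0 t1 sm1 q1 q2 g2.
have lo : s <= u * v.
  by rewrite -[leLHS]mulr1; apply: ler_pM => //; lra.
have up : u * v <= s * (1 + t) * (1 + D * t).
  by apply: ler_pM => //; lra.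
rewrite ger0_norm ?subr_ge0// lerBlDl (le_trans up)//.
have -> : s * (1 + t) * (1 + D * t) = s + s * t * (1 + D + D * t) by ring.
rewrite lerD2l; apply: (@le_trans _ _ (1 * (1 + D + D * t))).
  by rewrite ler_wpM2r// !addr_ge0// mulr_ge0// ltW.
by rewrite mul1r lerD2l ler_piMr.
Qed.

End ModeSumAsymptotics.

(** * The law of the order statistics *)

Section SortedThreshold.
Context {R : realType}.
Implicit Types (x : R) (s : seq R) (i : nat).

Lemma sorted_nth_le s x i : sorted <=%R s -> (i < size s)%N ->
  (nth 0 s i <= x) = (i < count (fun y => (y <= x)%R) s)%N.
Proof.
elim: s i => [//|y s IH] i /= ys.
have ss : sorted <=%R s by exact: path_sorted ys.
have [yx|xy] := lerP y x.
  case: i => [_|i] /=; first by rewrite yx.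
  by rewrite ltnS => si; rewrite IH// add1n ltnS.
have -> : count (fun y => (y <= x)%R) s = 0%N.
  apply/eqP; rewrite -leqn0 leqNgt -has_count; apply/hasPn => z zs.
  rewrite -ltNge (lt_le_trans xy)//.
  by have /allP/(_ z zs) := order_path_min le_trans ys.
rewrite add0n ltn0; case: i => [_|i] /=; first by rewrite leNgt xy.
rewrite ltnS => si; apply/negbTE; rewrite -ltNge (lt_le_trans xy)//.
by have /allP/(_ _ (mem_nth 0 si)) := order_path_min le_trans ys.
Qed.

Lemma order_stat_le (T : Type) (n : nat) (U : 'I_n -> T -> R) (i : 'I_n) x w :
  (order_stat U i w <= x) = (i < #|[set j | (U j w <= x)%R]%SET|)%N.
Proof.
rewrite /order_stat sorted_nth_le; last 2 first.
- exact: sort_le_sorted.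
- by rewrite size_sort size_map size_enum_ord.
rewrite (permP (permEl (perm_sort _ _))) count_map; congr (_ < _)%N.
rewrite cardE -size_filter /enum_mem; congr size.
by rewrite -filter_predI; apply: eq_filter => j /=; rewrite !inE andbT.
Qed.

End SortedThreshold.

(** * Distribution function of an order statistic *)

Section OrderStatLaw.
Context {R : realType} {d : measure_display} {T : measurableType d}
  (P : probability T R) {n : nat} (U : 'I_n -> {RV P >-> R}).
Implicit Types (x : R) (i : 'I_n).

(** For fixed [x] these events are disjoint and cover the space. Each is an intersection of
    conditions on single variables, so independence computes its probability, and sublevel sets of
    order statistics are finite unions of them. *)
Let below x (J : {set 'I_n}) : set T := [set w : T | [set j | (U j w <= x)%R]%SET = J].

Let belowE x (J : {set 'I_n}) : below x J =
  \bigcap_(j in [set` [set: 'I_n]%SET])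
     (U j @^-1` (if j \in J then `]-oo, x]%classic else `]x, +oo[%classic)).
Proof.
apply/seteqP; split=> w.
  move=> /= wJ j _; rewrite /= -wJ inE.
  by case: ifPn => /=; rewrite in_itv/= ?andbT// -ltNge.
move=> /= wJ; apply/setP => j; rewrite inE.
have := wJ j; rewrite /= inE => /(_ isT).
by case: (j \in J) => /=; rewrite in_itv/= ?andbT// => h; apply/negbTE; rewrite -ltNge.
Qed.

Let mbelow x J : measurable (below x J).
Proof.
rewrite belowE; apply: fin_bigcap_measurable; first exact: finite_finset.
by move=> j _; rewrite -[X in measurable X]setTI; apply: measurable_funP => //; case: ifP.
Qed.

Lemma order_stat_leE i x : [set w | order_stat (fun j => U j) i w <= x] =
  \bigcup_(J in [set J : {set 'I_n} | (i < #|J|)%N]) below x J.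
Proof.
apply/seteqP; split=> w /=; rewrite order_stat_le.
  by move=> h; exists [set j | (U j w <= x)%R]%SET.
by move=> [J /= h ->].
Qed.

Lemma measurable_order_stat i : measurable_fun setT (order_stat (fun j => U j) i).
Proof.
have := @measurability _ _ T R setT (order_stat (fun j => U j) i) _ (RGenOInfty.measurableE R).
apply => _ [_ [x ->] <-].
rewrite setTI; have -> : order_stat (fun j => U j) i @^-1` `]x, +oo[ =
   ~` [set w | order_stat (fun j => U j) i w <= x].
  by apply/seteqP; split=> w /=; rewrite in_itv/= andbT ltNge => /negP.
apply: measurableC; rewrite order_stat_leE.
by apply: fin_bigcup_measurable => //; exact: finite_finset.
Qed.

Lemma order_stat_cdf (f : R) i x : mutually_independent U ->
  (forall j, P (U j @^-1` `]-oo, x]) = f%:E) ->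
  P [set w | order_stat (fun j => U j) i w <= x] =
  (\sum_(J : {set 'I_n} | (i < #|J|)%N) (f ^+ #|J| * (1 - f) ^+ (n - #|J|)))%:E.
Proof.
move=> Uind Uf.
have Uf' j : P (U j @^-1` `]x, +oo[) = (1 - f)%:E.
  have -> : U j @^-1` `]x, +oo[ = ~` (U j @^-1` `]-oo, x]).
    by rewrite preimage_setC setCitvl.
  rewrite probability_setC ?Uf//.
  by rewrite -[X in measurable X]setTI; exact: measurable_funP.
have PJ J : P (below x J) = (f ^+ #|J| * (1 - f) ^+ (n - #|J|))%:E.
  rewrite belowE Uind; last by move=> j; case: ifP.
  rewrite (eq_bigr (fun j => (if j \in J then f else 1 - f)%:E)); last first.
    by move=> j _; case: ifP.
  rewrite prodEFin (bigID (mem J))/=; congr (_ * _)%:E.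
    rewrite (eq_bigr (fun=> f)) => [|j /andP[_ ->]//].
    rewrite prodr_const; congr (_ ^+ _); by apply: eq_card => j; rewrite unfold_in/= inE.
  rewrite (eq_bigr (fun=> 1 - f)) => [|j /andP[_ /negbTE ->]//].
  rewrite prodr_const; congr (_ ^+ _).
  have <- : #|~: J| = (n - #|J|)%N by rewrite cardsCs finset.setCK card_ord.
  by apply: eq_card => j; rewrite unfold_in/= !inE.
have fin := @finite_finset {set 'I_n} [set J : {set 'I_n} | (i < #|J|)%N].
rewrite order_stat_leE measure_fin_bigcup//; last by move=> J J' _ _ [w [/= <- <-]].
rewrite fsbig_finite//=.
under eq_bigr do rewrite PJ.
rewrite sumEFin; congr (_%:E); rewrite -[RHS]big_filter.
apply: perm_big; apply: uniq_perm.
- exact: finmap.fset_uniq.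
- by rewrite filter_uniq// index_enum_uniq.
- move=> J; rewrite mem_filter mem_index_enum andbT in_fset_set//.
  by apply/idP/idP => [/set_mem//|iJ]; exact: mem_set.
Qed.

End OrderStatLaw.

Section BetaLaw.
Context {R : realType}.
Implicit Types (f x : R) (n i k : nat).

Definition binom_tail n i (f : R) : R :=
  \sum_(J : {set 'I_n} | (i < #|J|)%N) (f ^+ #|J| * (1 - f) ^+ (n - #|J|)).

Lemma binom_tailE n i f :
  binom_tail n i f = \sum_(k < n.+1 | (i < k)%N) 'C(n, k)%:R * (f ^+ k * (1 - f) ^+ (n - k)).
Proof.
have cardJ (J : {set 'I_n}) : (#|J| < n.+1)%N.
  by rewrite ltnS -[X in (_ <= X)%N](card_ord n) max_card.
rewrite /binom_tail (partition_big (fun J : {set 'I_n} => Ordinal (cardJ J)) (fun k : 'I_n.+1 => (i < k)%N))//=.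
apply: eq_bigr => k ik.
rewrite (eq_bigr (fun=> f ^+ k * (1 - f) ^+ (n - k))); last first.
  by move=> J /andP[_ /eqP <-].
rewrite sumr_const mulr_natl; congr (_ *+ _).
rewrite -[X in 'C(X, _)](card_ord n) -card_draws; apply: eq_card => J.
rewrite !inE unfold_in /=; apply/andP/eqP => [[_ /eqP <-]//|E].
by split; [rewrite E|apply/eqP/val_inj].
Qed.

End BetaLaw.

(** * Beta distribution functions as binomial tails *)

Section BetaCdf.
Context {R : realType}.
Notation mu := (@lebesgue_measure R).
Implicit Types (x : R) (m n i k l : nat).

Lemma deriv_binom_poly k l : (binom_poly k l)^`() =
  k%:R *: binom_poly k.-1 l - l%:R *: binom_poly k l.-1 :> {poly R}.
Proof.
rewrite binom_poly.unlock derivM derivXn deriv_exp derivB derivX derivC sub0r.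
rewrite mulN1r mulNrn -(scaler_nat k) -(scaler_nat l) mulrN.
by rewrite -scalerAl -scalerAr.
Qed.

Definition binom_tail_poly n i : {poly R} :=
  \sum_(i.+1 <= k < n.+1) 'C(n, k)%:R *: binom_poly k (n - k).

Lemma horner_binom_tail_poly n i x : (binom_tail_poly n i).[x] = binom_tail n i x.
Proof.
rewrite binom_tailE /binom_tail_poly horner_sum big_geq_mkord/=.
by apply: eq_bigr => k _; rewrite hornerZ binom_polyE.
Qed.

(** The derivative of each term is a difference of consecutive values of [phi]. The sum telescopes
    to [phi i], the beta density, as [phi] vanishes at [m + 1]. *)
Lemma deriv_binom_tail_poly m i : (i <= m)%N ->
  (binom_tail_poly m.+1 i)^`() = (m.+1 * 'C(m, i))%:R *: binom_poly i (m - i).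
Proof.
move=> im; pose phi k : {poly R} := (m.+1 * 'C(m, k))%:R *: binom_poly k (m - k).
rewrite /binom_tail_poly (big_morph _ (@derivD R) (derivC 0)) big_add1 /=.
rewrite (eq_big_nat _ _ (F2 := fun k => - (phi k.+1 - phi k))); last first.
  move=> k /andP[_ km]; rewrite derivZ deriv_binom_poly subSS scalerBr !scalerA /= opprB.
  congr (_ *: _ - _).
    by rewrite mulrC -natrM mul_bin_diag.
  rewrite /phi subnS; congr (_ *: _).
  by rewrite mulrC -natrM (mul_bin_down m.+1 k.+1) subSS.
rewrite sumrN telescope_sumr; last exact: leqW.
by rewrite {1}/phi bin_small// muln0 scale0r sub0r opprK.
Qed.

(** The distribution function of the uniform law on [[0, 1]]. *)
Definition clip x : R := Num.max 0 (Num.min x 1).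

Lemma clip01 x : 0 <= clip x <= 1.
Proof. by rewrite /clip le_max lexx/= ge_max ler01 ge_min lexx orbT. Qed.

Lemma binom_tail0 n i : binom_tail n i 0 = 0 :> R.
Proof.
apply: big1 => J iJ; rewrite expr0n; case: #|J| iJ => //= ? _.
by rewrite mul0r.
Qed.

Lemma beta_fun_inv m i : (i <= m)%N ->
  (beta_fun i.+1 (m.+1 - i))^-1 = (m.+1 * 'C(m, i))%:R :> R.
Proof.
move=> im; rewrite subSn// beta_fun_fact subnKC// factS -(bin_fact im) !natrM.
have f0 k : k`!%:R != 0 :> R by rewrite pnatr_eq0 -lt0n fact_gt0.
have b0 : 'C(m, i)%:R != 0 :> R by rewrite pnatr_eq0 -lt0n bin_gt0.
have n0 : m.+1%:R != 0 :> R by rewrite pnatr_eq0.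
move: ('C(m, i)%:R) (m.+1%:R) (i`!%:R) ((m - i)`!%:R) b0 n0 (f0 i) (f0 (m - i)%N).
by move=> b n u v b0 n0 u0 v0; field; rewrite b0 n0 u0 v0.
Qed.

Lemma beta_prob_cdf m i x : (i <= m)%N ->
  beta_prob i.+1 (m.+1 - i) `]-oo, x] = (binom_tail m.+1 i (clip x))%:E.
Proof.
move=> im; have [c0 c1] := andP (clip01 x).
rewrite -integral_beta_pdf//= /beta_pdf.
pose c : R := (m.+1 * 'C(m, i))%:R; rewrite beta_fun_inv// -/c.
under eq_integral do rewrite EFinM.
rewrite ge0_integralZr//; last 3 first.
- apply/measurable_EFinP; apply: measurable_funTS; apply/measurable_restrict => //.
  by rewrite setTI; exact: measurable_XMonemX.
- move=> y _; rewrite lee_fin patchE; case: ifPn => //.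
  by rewrite inE/= => y01; exact: XMonemX_ge0.
- by rewrite lee_fin.
rewrite integral_XMonemX_restrict.
have key : (\int[mu]_(y in `[0%R, clip x]) (XMonemX i (m - i) y)%:E * c%:E =
   (binom_tail m.+1 i (clip x))%:E)%E.
  have -> : (\int[mu]_(y in `[0%R, clip x]) (XMonemX i (m - i) y)%:E)%E =
      (poly_int 0 (clip x) (binom_poly i (m - i)))%:E.
    rewrite /poly_int /Rintegral fineK.
      by apply: eq_integral => y _; rewrite binom_polyE.
    apply: integrable_fin_num => //.
    exact/integrable_continuous/continuous_horner.
  rewrite -EFinM mulrC -poly_intZ -deriv_binom_tail_poly// poly_int_deriv//.
  by rewrite !horner_binom_tail_poly binom_tail0 subr0.
rewrite subSn//=; have [x0|x0] := lerP 0 x.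
  rewrite -key; congr (_ * _)%E; congr (integral _ _ _).
  apply/seteqP; split=> y /=; rewrite !in_itv/= /clip.
    by move=> [yx /andP[y0 y1]]; rewrite y0 le_max le_min yx y1 orbT.
  rewrite (max_idPr _) ?le_min ?x0 ?ler01//.
  by move=> /and3P[y0 yx y1]; split=> //; rewrite y0.
have -> : clip x = 0.
  by rewrite /clip (max_idPl _)// ge_min (ltW x0).
rewrite binom_tail0 (_ : _ `&` _ = set0) ?integral_set0 ?mul0e//.
rewrite -subset0 => y [] /=; rewrite !in_itv/= => yx /andP[y0 _].
by have := le_lt_trans (le_trans y0 yx) x0; rewrite ltxx.
Qed.

Lemma eq_probability_cdf (m1 m2 : probability (measurableTypeR R) R) :
  (forall x, m1 `]-oo, x]%classic = m2 `]-oo, x]%classic) ->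
  forall A, measurable A -> m1 A = m2 A.
Proof.
move=> H A mA.
apply: (@measure_unique _ R (measurableTypeR R) (@RGenOInfty.G R)
  (fun k => `]- k%:R, +oo[%classic) (RGenOInfty.measurableE R) _ _ _ m1 m2 _ _ A mA).
- move=> _ _ [x ->] [y ->]; exists (Num.max x y).
  apply/seteqP; split=> z /=; rewrite !in_itv/= !andbT gt_max.
    by move=> [-> ->].
  by move=> /andP[].
- by move=> k; exists (- k%:R).
- apply/seteqP; split=> // x _; exists (Num.truncn (- x)).+1 => //=.
  by rewrite in_itv/= andbT ltrNl truncnS_gt.
- move=> _ [x ->].
  have -> : `]x, +oo[%classic = ~` `]-oo, x]%classic :> set (measurableTypeR R).
    by rewrite setCitvl.
  have mI : measurable (`]-oo, x]%classic : set (measurableTypeR R)) by [].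
  by apply: etrans (probability_setC m1 mI) _; rewrite H -(probability_setC m2 mI).
- by move=> k; rewrite (le_lt_trans (probability_le1 _ _)) ?ltry.
Qed.

End BetaCdf.

(** * Expected displacement of a single sensor *)

Section OrderStatExpectation.
Context {R : realType} {d : measure_display} {T : measurableType d}
  (P : probability T R) {m : nat} (U : 'I_m.+1 -> {RV P >-> R}).
Hypothesis U_unif : forall i, uniform_on_unit_interval (U i).
Hypothesis U_indep : mutually_independent U.
Notation mu := (@lebesgue_measure R).

Lemma uniform_cdf (i : 'I_m.+1) (x : R) : P (U i @^-1` `]-oo, x]) = (clip x)%:E.
Proof.
have -> : P (U i @^-1` `]-oo, x]) = distribution P (U i) `]-oo, x] by [].
(* The uniform law is the beta law with both parameters 1, so its distribution function is the case
   [m = i = 0] of [beta_prob_cdf]. *)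
rewrite U_unif// -beta_prob_uniform (beta_prob_cdf 0 0)//.
rewrite binom_tailE big_mkcond/= !big_ord_recl big_ord0 /=.
by rewrite /bump /= add0r addr0 bin1 mul1r expr1 subnn expr0 mulr1.
Qed.

Lemma order_stat_law (i : 'I_m.+1) (g : R -> \bar R) :
  measurable_fun setT g -> (forall x, 0 <= g x)%E ->
  (\int[P]_w g (order_stat (fun j => U j) i w) =
   \int[beta_prob i.+1 (m.+1 - i)]_x g x)%E.
Proof.
move=> mg g0.
have mX : measurable_fun [set: T] (order_stat (fun j => U j) i : T -> measurableTypeR R).
  exact: measurable_order_stat.
pose X : {mfun T >-> measurableTypeR R} := HB.pack
  (order_stat (fun j => U j) i : T -> measurableTypeR R) (isMeasurableFun.Build _ _ _ _ _ mX).
have := @ge0_integral_distribution _ _ T (measurableTypeR R) R P X g mg g0; rewrite /= => <-.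
have law x : distribution P X `]-oo, x]%classic =
    beta_prob i.+1 (m.+1 - i) `]-oo, x]%classic.
  apply: etrans _ (esym (beta_prob_cdf m i x (ltn_ord i))).
  rewrite -(order_stat_cdf P U (clip x) i x)//; last by move=> j; exact: uniform_cdf.
apply: eq_measure_integral => A mA _.
exact: (eq_probability_cdf (distribution P X) (beta_prob i.+1 (m.+1 - i)) law).
Qed.

Lemma order_stat_expectation (i : 'I_m.+1) (t : R) (a : nat) :
  'E_P[(fun w => `|order_stat (fun j => U j) i w - t| ^+ a)%R]%E =
  ((m.+1 * 'C(m, i))%:R *
    \int[mu]_(x in `[0, 1]) (`|x - t| ^+ a * (binom_poly i (m - i)).[x]))%:E.
Proof.
have im : (i <= m)%N by rewrite -ltnS.
have mr : measurable_fun setT (fun x : R => `|x - t| ^+ a).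
  by apply: measurable_funX; apply: measurableT_comp => //; exact: measurable_funB.
have mg : measurable_fun setT (fun x : R => (`|x - t| ^+ a)%:E) by exact/measurable_EFinP.
have g0 (x : R) : (0 <= (`|x - t| ^+ a)%:E)%E by rewrite lee_fin exprn_ge0.
rewrite unlock (order_stat_law i _ mg g0).
(* The beta law does not charge the complement of [[0, 1]]. Restricting to [[0, 1]] makes the cost
   bounded, which gives the finiteness required to pass to the density. *)
rewrite (@ge0_negligible_integral _ _ R (beta_prob i.+1 (m.+1 - i)) setT (~` `[0, 1]%classic))//; last 2 first.
- exact: measurableC.
- have mI : measurable (`[0, 1]%classic : set (measurableTypeR R)) by [].
  apply: etrans (probability_setC (beta_prob i.+1 (m.+1 - i)) mI) _.
  by apply: etrans (congr1 (fun z => 1 - z)%E (beta_prob01 _ _)) _; rewrite subee.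
rewrite setTD setCK integral_beta_prob//; last 2 first.
- exact: measurable_funTS.
- apply: (@le_lt_trans _ _ (\int[beta_prob i.+1 (m.+1 - i)]_(x in `[0%R, 1%R])
      (((1 + `|t|) ^+ a)%:E))%E); last first.
    rewrite integral_cst//= -ge0_fin_numE; last by rewrite mule_ge0// lee_fin exprn_ge0// addr_ge0.
    by rewrite fin_numM// beta_prob_fin_num.
  apply: ge0_le_integral => //=.
  + apply: measurable_funTS; apply/measurable_EFinP.
    have := measurableT_comp (@normr_measurable R setT) mr; exact.
  + move=> x; rewrite in_itv/= => /andP[x0 x1]; rewrite lee_fin ger0_norm ?exprn_ge0//.
    rewrite lerXn2r ?nnegrE ?addr_ge0// (le_trans (ler_normB _ _))// lerD2r.
    by rewrite ger0_norm.
have int : mu.-integrable `[0, 1] (EFin \o (fun x => `|x - t| ^+ a * (binom_poly i (m - i)).[x])).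
  rewrite (_ : (fun x => `|x - t| ^+ a * _) =
    (fun x => `|('X - t%:P).[x]| ^+ a * (binom_poly i (m - i)).[x])); last first.
    by apply/funext => x; rewrite !hornerE.
  exact/integrable_continuous/continuous_abs_kernel.
rewrite -RintegralZl// /Rintegral fineK; last first.
  apply: integrable_fin_num => //.
  have mI : measurable (`[0, 1]%classic : set (measurableTypeR R)) by [].
  exact: (integrableZl mI (m.+1 * 'C(m, i))%:R int).
apply: eq_integral => x x01; rewrite -EFinM /beta_pdf beta_fun_inv// patchE x01.
by congr (_%:E); rewrite subSn// /XMonemX binom_polyE mulrA mulrC.
Qed.

End OrderStatExpectation.

(** * The expected cost *)

Section SumAsymptotics.
Context {R : realType}.
Implicit Types (m n p : nat).

(** The constant of the theorem at [a = 2 p + 1], where [a / 2 + 1 = p + 3/2] and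
    [1 + a = 2 (p + 1)]. *)
Definition sensor_const p : R :=
  Gamma (p.+1%:R + 2^-1) / (2 ^+ p * Num.sqrt 2 * (2 * p.+1%:R)).

(** The right side is what the reduction and [mode_sum_asymp] produce. Duplication at [p + 1]
    expresses [(2p + 2)! * Gamma (1/2)] through [Gamma (p + 3/2)], which cancels one of its two
    occurrences. *)
Lemma sensor_constE p : sensor_const p =
  2 ^+ p * p`!%:R * (2 * (Gamma (p.+1%:R + 2^-1) ^+ 2 / (stirling_const * (2 * p.+1)`!%:R))).
Proof.
have alg (g G r f F t u : R) : 0 < g -> 0 < G -> 0 < r -> 0 < f -> 0 < F -> 0 < t ->
    0 < u -> G * (4 * t ^+ 2 * (u * f)) = F * g ->
    G / (t * r * (2 * u)) = t * f * (2 * (G ^+ 2 / (r * g * F))).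
  move=> g0 G0 r0 f0 F0 t0 u0 E.
  have -> : r * g * F = r * (G * (4 * t ^+ 2 * (u * f))) by rewrite E; ring.
  by field; rewrite !gt_eqF.
apply: alg; rewrite ?exprn_gt0 ?sqrtr_gt0 ?ltr0n ?fact_gt0//.
- by rewrite -[2^-1]add0r; exact: (Gamma_half_gt0 0).
- exact: Gamma_half_gt0.
- rewrite -Gamma_half_fact factS natrM; congr (_ * (_ * _)).
  by rewrite [RHS]exprS -[(2 ^+ p) ^+ 2]exprM mulnC exprM; congr (_ * _ ^+ _); ring.
Qed.

(** The moments are expanded in [m = n - 1] while the theorem is stated in [n]; the difference is
    again of the order of the error. *)
Lemma half_pow_shift p : exists2 C : R, 0 <= C & forall m, (0 < m)%N ->
  `|half_pow p m.+1 - half_pow p m| <= C * m%:R ^+ p.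
Proof.
have [C C0 HC] := @expr_1Ddiv_bound R 1 p.+1 ler01.
exists C => // m m0; have x0 : 0 < m%:R :> R by rewrite ltr0n.
rewrite ger0_norm; last by rewrite subr_ge0; exact: half_pow_le.
have t0 : 0 <= 1 / m%:R :> R by rewrite divr_ge0.
have E : m.+1%:R = m%:R * (1 + 1 / m%:R) :> R.
  by rewrite mulrDr mulr1 mul1r divff ?gt_eqF// natr1.
have : half_pow p m.+1 <= half_pow p m * (1 + C / m%:R).
  apply: (@le_trans _ _ (m%:R ^+ p * (1 + 1 / m%:R) ^+ p *
     (Num.sqrt m%:R * (1 + 1 / m%:R)))).
    rewrite {1}/half_pow {1}E exprMn ler_wpM2l//.
    by apply: sqrt_le_1D; rewrite // ltW.
  by rewrite mulrACA -exprSr ler_wpM2l ?half_pow_ge0// HC.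
have := ler_wpM2l C0 (half_pow_div (R := R) p m).
rewrite mulrDr mulr1 (mulrCA (half_pow p m) C).
by move: (half_pow p m) (half_pow p m.+1) (C * _) (C * _) => *; lra.
Qed.

Lemma shifted_binom_moment_asymp p : exists2 C : R, 0 <= C & forall m, (0 < m)%N ->
  `|shifted_binom_moment m (2 * p).+1 - sensor_const p * half_pow p m.+1| <= C * m%:R ^+ p.
Proof.
have [C1 C10 H1] := @shifted_binom_moment_odd R p.
have [C2 C20 H2] := @mode_sum_asymp R p.
have [C3 C30 H3] := half_pow_shift p.
set K : R := 2 ^+ p * p`!%:R in H1.
have K0 : 0 <= K by rewrite mulr_ge0// exprn_ge0.
have c0 : 0 <= sensor_const p.
  rewrite divr_ge0 ?(ltW (Gamma_half_gt0 _))// !mulr_ge0 ?exprn_ge0 ?sqrtr_ge0//.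
exists (C1 + 2 * K * C2 + sensor_const p * C3).
  apply: addr_ge0; last exact: mulr_ge0.
  by apply: addr_ge0 => //; apply: mulr_ge0 => //; exact: mulr_ge0.
move=> m m0; have := H1 m m0; have := H2 m m0; have := H3 m m0.
have sE := sensor_constE p; rewrite -/K in sE.
move: (shifted_binom_moment _ _) (mode_sum _ _) => V S h3 h2 h1.
set kap := _ / _ in sE h2; set c := sensor_const p in sE c0 *.
have -> : V - c * half_pow p m.+1 = (V - m%:R ^+ p * K * (2 * S)) +
   m%:R ^+ p * (2 * K) * (S - kap * Num.sqrt m%:R) - c * (half_pow p m.+1 - half_pow p m).
  by rewrite /half_pow sE; ring.
have mp : 0 <= m%:R ^+ p :> R by rewrite exprn_ge0.
rewrite 2!(mulrDl _ _ (m%:R ^+ p)).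
apply: le_trans (ler_normB _ _) _; apply: lerD.
  apply: le_trans (ler_normD _ _) _; apply: lerD => //.
  have mK : 0 <= m%:R ^+ p * (2 * K) by apply: mulr_ge0 => //; exact: mulr_ge0.
  by rewrite normrM ger0_norm// [leRHS]mulrC [leRHS]mulrA ler_wpM2l.
by rewrite normrM ger0_norm// -mulrA ler_wpM2l.
Qed.

End SumAsymptotics.

(** * The total cost as a binomial moment *)

Section SensorSum.
Context {R : realType} {d : measure_display} {T : measurableType d}
  (P : probability T R) {m : nat} (U : 'I_m.+1 -> {RV P >-> R}).
Hypothesis U_unif : forall i, uniform_on_unit_interval (U i).
Hypothesis U_indep : mutually_independent U.

Lemma sensor_sumE (p : nat) :
  (\sum_(i < m.+1)
     'E_P[(fun w => `|order_stat (fun j => U j) i w - anchor i| ^+ (2 * p).+1)%R])%E =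
  (shifted_binom_moment m (2 * p).+1 / m.+1%:R ^+ (2 * p))%:E.
Proof.
have n0 : 0 < m.+1%:R :> R by [].
have nn0 : m.+1%:R != 0 :> R by rewrite gt_eqF.
rewrite (eq_bigr (fun i : 'I_m.+1 =>
  ('C(m, i)%:R * shifted_moment i (m - i) (2 * p).+1 / m.+1%:R ^+ (2 * p))%:E)); last first.
  move=> i _; have im : (i <= m)%N by rewrite -ltnS.
  rewrite order_stat_expectation//; congr (_%:E).
  pose f x : R := `|(dev_poly i (m - i) + ((2^-1)%:P - 'X)).[x]| ^+ (2 * p).+1 *
    (binom_poly i (m - i)).[x].
  have -> : shifted_moment i (m - i) (2 * p).+1 = \int[lebesgue_measure]_(x in `[0, 1]) f x.
    by apply: eq_Rintegral => x _; rewrite /f !hornerE.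
  have -> : \int[lebesgue_measure]_(x in `[0, 1])
      (`|x - anchor i| ^+ (2 * p).+1 * (binom_poly i (m - i)).[x]) =
      \int[lebesgue_measure]_(x in `[0, 1]) (m.+1%:R ^- (2 * p).+1 * f x).
    apply: eq_Rintegral => x _; rewrite /f mulrA; congr (_ * _).
    (* The ordinal [i] counts the sensors to the left, and the anchor is [(i + 1/2) / n], so the
       displacement is [(i + 1/2 - n x) / n] up to sign. One of the [2 p + 1] factors [1 / n]
       cancels against the [n] of the beta density. *)
    have -> : x - anchor i = - (m.+1%:R^-1 * (dev_poly i (m - i) + ((2^-1)%:P - 'X)).[x]).
      rewrite !hornerD hornerN hornerX hornerC dev_polyE subnKC// /anchor -[i.+1%:R]natr1 -[m.+1%:R]natr1.
      by field; rewrite natr1.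
    by rewrite normrN normrM exprMn ger0_norm ?invr_ge0// exprVn.
  rewrite RintegralZl//; last exact/integrable_continuous/continuous_abs_kernel.
  rewrite natrM exprS; have N0 := expf_neq0 (2 * p) nn0.
  move: (m.+1%:R ^+ (2 * p)) N0 => N N0; move: (m.+1%:R) nn0 => u u0.
  by field; rewrite N0 u0.
rewrite sumEFin; congr (_%:E).
by rewrite /shifted_binom_moment mulr_suml.
Qed.

End SensorSum.

Lemma powR_half_nat (R : realType) (x : R) (p : nat) : 0 < x ->
  x `^ (p%:R + 2^-1) = x ^+ p * Num.sqrt x.
Proof.
move=> x0; rewrite powRD ?gt_eqF ?implybT// powR_mulrn ?powR12_sqrt ?ltW//.
Qed.

Theorem theorem2 (R : realType) (a : nat) (a_odd : odd a)
  (d : nat -> measure_display)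
  (T : forall n : nat, measurableType (d n))
  (P : forall n : nat, probability (T n) R)
  (U : forall n : nat, 'I_n -> {RV (P n) >-> R})
  (U_unif : forall (n : nat) (i : 'I_n), uniform_on_unit_interval (U n i))
  (U_indep : forall n : nat, mutually_independent (U n)) :
  exists2 e : nat -> R,
    e =O_\oo (fun n : nat => 1 / n%:R `^ ((a%:R - 1) / 2) : R) &
    forall n : nat, (0 < n)%N ->
      (\sum_(i < n)
         'E_(P n)[(fun w => `|order_stat (U n) i w - anchor i| ^+ a)%R])%E =
      (Gamma (a%:R / 2 + 1) / (2 `^ (a%:R / 2) * (1 + a%:R))
         * (1 / n%:R `^ (a%:R / 2 - 1)) + e n)%:E.
Proof.
have [p ->] : exists p, a = (2 * p).+1.
  by exists a./2; rewrite -[LHS]odd_double_half a_odd add1n mul2n.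
have aE : (2 * p).+1%:R = 2 * p%:R + 1 :> R by rewrite -natr1 natrM.
have [C C0 HC] := @shifted_binom_moment_asymp R p.
(* The witness is the exact remainder, so the identity holds for every positive [n]; only the [O]
   bound is asymptotic. *)
exists (fun n => (shifted_binom_moment n.-1 (2 * p).+1 - sensor_const p * half_pow p n)
  / n%:R ^+ (2 * p)).
  apply/eqO_exP; exists (C + 1); first by rewrite ltr_wpDl.
  (* The bound on the moments is available for [m = n - 1] positive. *)
  near=> n; have n1 : (1 < n)%N by near: n; exact: nbhs_infty_gt.
  have n0 : 0 < n%:R :> R by rewrite ltr0n ltnW.
  have -> : ((2 * p).+1%:R - 1) / 2 = p%:R :> R by rewrite aE; field.
  rewrite powR_mulrn ?(ltW n0)// div1r normrM !normfV.
  rewrite [X in _ * X^-1 <= _]ger0_norm ?exprn_ge0 ?(ltW n0)//.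
  rewrite [X in _ <= _ * X^-1]ger0_norm ?exprn_ge0 ?(ltW n0)//.
  have m0 : (0 < n.-1)%N by rewrite -ltnS prednK// ltnW.
  have := HC n.-1 m0; rewrite prednK ?(ltnW n1)// => H.
  have np : 0 < n%:R ^+ p :> R by rewrite exprn_gt0.
  have N2 : n%:R ^+ (2 * p) = (n%:R ^+ p) ^+ 2 :> R by rewrite mulnC exprM.
  rewrite ler_pdivrMr ?exprn_gt0// N2.
  have -> : (C + 1) / n%:R ^+ p * (n%:R ^+ p) ^+ 2 = (C + 1) * n%:R ^+ p.
    by field; rewrite gt_eqF.
  apply: (le_trans H); apply: ler_pM => //; rewrite ?exprn_ge0 ?lerDl//.
  by rewrite lerXn2r ?nnegrE ?(ltW n0)// ler_nat leq_pred.
move=> [//|m] _.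
rewrite (sensor_sumE (P m.+1) (U m.+1) (U_unif m.+1) (U_indep m.+1)).
congr (_%:E) => /=.
have n0 : 0 < m.+1%:R :> R by [].
have -> : Gamma ((2 * p).+1%:R / 2 + 1) / (2 `^ ((2 * p).+1%:R / 2) * (1 + (2 * p).+1%:R)) =
    sensor_const p :> R.
  rewrite /sensor_const.
  have -> : (2 * p).+1%:R / 2 + 1 = p.+1%:R + 2^-1 :> R.
    by rewrite aE -[p.+1%:R]natr1; field.
  have -> : (2 * p).+1%:R / 2 = p%:R + 2^-1 :> R by rewrite aE; field.
  rewrite powR_half_nat//; congr (_ / (_ * _)).
  by rewrite aE -[p.+1%:R]natr1; ring.
(* Both sides are [n^(1/2 - p)]; the exponent [a / 2 - 1] is negative when [p = 0], so one factor
   [n] is split off before turning to natural powers. *)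
have -> : 1 / m.+1%:R `^ ((2 * p).+1%:R / 2 - 1) = half_pow p m.+1 / m.+1%:R ^+ (2 * p) :> R.
  have -> : (2 * p).+1%:R / 2 - 1 = (p%:R + 2^-1) - 1 :> R by rewrite aE; field.
  have r0 : 0 < p%:R + 2^-1 :> R by rewrite ltr_wpDl// invr_gt0.
  have h := mulr_powRB1 (ltW n0) r0; rewrite (powR_half_nat R _ _ n0) in h.
  have -> : m.+1%:R `^ (p%:R + 2^-1 - 1) = m.+1%:R ^+ p * Num.sqrt m.+1%:R / m.+1%:R :> R.
    by rewrite -h [RHS]mulrC mulKf// gt_eqF.
  rewrite mulnC exprM /half_pow.
  have s0 : 0 < Num.sqrt m.+1%:R :> R by rewrite sqrtr_gt0.
  have xp : 0 < m.+1%:R ^+ p :> R by rewrite exprn_gt0.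
  move: (m.+1%:R ^+ p) xp => X xp.
  move: (Num.sqrt m.+1%:R) s0 (sqr_sqrtr (ltW n0)) => s s0 <-.
  by field; rewrite !gt_eqF.
by rewrite mulrBl; ring.
Unshelve. all: by end_near. Qed.
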